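(* Let $d\ge 2$ and $0<\alpha<d$, and let $\mathcal P$ be a simple point process on $\mathbb R^d$ satisfying Assumptions (A1) and (A2). Then for every $i\in\{1,2,3\}$ and every $\varepsilon>0$ there exists $\delta>0$ such that, $\mathcal P$-a.s., for all $L$ sufficiently large, $$\varphi^i_L(t)\ \ge\ \delta\,\min\Big\{\frac{1}{L^{\varepsilon}},\ \frac{1}{t^{1/d}L}\Big\}\qquad\text{for all } 0<t\le \tfrac12 .$$ In particular, $\mathcal P$-a.s., $\Phi^i_L\ge \delta L^{-1}$ for all $L$ sufficiently large.
   Context: $\Omega$ is the set of locally finite subsets $\xi\subset\mathbb R^d$, with the $\sigma$-algebra generated by the counting variables $\xi\mapsto \#(\xi\cap\Lambda)$, $\Lambda$ bounded Borel; a simple point process is a probability measure $\mathcal P$ on $\Omega$, and $\xi(\Lambda):=\#(\xi\cap\Lambda)$. For $L\in\mathbb N$, $\Lambda_L=[-L/2,L/2]^d$ and $\xi_L=\xi\cap\Lambda_L$. Models: for $x\in\xi_L$ let $w^1_x=1$, $w^2_x=\sum_{z\in\xi_L,z\ne x}e^{-|x-z|^\alpha}$, $w^3_x=\max\{1,w^2_x\}$. For $U\subset\xi_L$ let $W^i(U)=\sum_{x\in U}w^i_x$. For nonempty $U\subset\xi_L$ with $U^c=\xi_L\setminus U$, set $I^i_U=\frac{1}{W^i(U)}\sum_{x\in U,y\in U^c}e^{-|x-y|^\alpha}$. The isoperimetric profile is $\varphi^i_L(t)=\inf\{I^i_U: \emptyset\ne U\subset\xi_L,\ W^i(U)\le t\,W^i(\xi_L)\}$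 for $t\in(0,1)$, and Cheeger's constant is $\Phi^i_L=\varphi^i_L(1/2)$. Convention: a sequence of events $E_L$ ''holds $\mathcal P$-a.s. for $L$ sufficiently large'' if there is $\Omega_0$ with $\mathcal P(\Omega_0)=1$ such that for each $\xi\in\Omega_0$ there is $L_0(\xi)<\infty$ with $\xi\in E_L$ for all integers $L\ge L_0(\xi)$. Assumption (A1): for every $0<p<1$ there exists $K>0$ such that the random field $\sigma_x(\xi)=\chi(\xi(xK+[0,K)^d)\ge1)$, $x\in\mathbb Z^d$, stochastically dominates the i.i.d. Bernoulli($p$) field on $\mathbb Z^d$. Assumption (A2): with $R_A(\xi)=\sum_{x\in\xi\cap A}\sum_{y\in\xi}e^{-|x-y|^\alpha}$ for bounded Borel $A$, for every $\varepsilon\in(0,1)$ there exists $C<\infty$ such that, $\mathcal P$-a.s., for $L$ sufficiently large, $R_{V_x}\le CL^{\varepsilon d}$ for all $x\in\mathbb Z^d$ with $V_x\cap\Lambda_L\neq\emptyset$, where $V_x=L^\varepsilon x+[0,L^\varepsilon)^d$. *)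

(* Defs.v *)
From HB Require Import structures.
From mathcomp Require Import all_boot all_order all_algebra.
From mathcomp Require Import all_classical all_reals all_analysis.
Set Implicit Arguments. Unset Strict Implicit. Unset Printing Implicit Defensive.
Import Order.TTheory GRing.Theory Num.Theory.
Import numFieldNormedType.Exports.
Local Open Scope classical_set_scope.
Local Open Scope ring_scope.

Section Defs.
Variables (R : realType) (d : nat).

Definition pt := 'rV[R]_d.
Definition Zd := 'rV[int]_d.

Definition edist (x y : pt) : R :=
  Num.sqrt (\sum_(i < d) (x ord0 i - y ord0 i) ^+ 2).

Definition kern (alpha : R) (x y : pt) : R := expR (- (edist x y `^ alpha)).

Definition bounded_pt (A : set pt) : Prop :=
  exists M : R, forall x, A x -> forall i, `|x ord0 i| <= M.

Definition borel_pt : set (set pt) := <<s [set A : set pt | open A] >>.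

Definition locfin (xi : set pt) : Prop :=
  forall A, bounded_pt A -> finite_set (xi `&` A).

Lemma locfin_set0 : locfin set0.
Proof. by move=> A _; rewrite set0I; exact: finite_set0. Qed.

Record config := Config { cpts : set pt ; cpts_locfin : locfin cpts }.

HB.instance Definition _ := gen_eqMixin config.
HB.instance Definition _ := gen_choiceMixin config.
HB.instance Definition _ := isPointed.Build config (Config locfin_set0).

Definition count_events : set (set config) :=
  [set E | exists (A : set pt) (n : nat),
     [/\ borel_pt A, bounded_pt A & E = [set xi : config | ((cpts xi `&` A) #= `I_n)%card]]].

Definition Omega := g_sigma_algebraType count_events.

Definition Lam (L : nat) : set pt :=
  [set x | forall i, - (L%:R / 2) <= x ord0 i <= L%:R / 2].
Definition xiL (xi : config) (L : nat) : set pt := cpts xi `&` Lam L.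

(* weights of the three models; S plays the role of xi_L *)
Definition w2 (alpha : R) (S : set pt) (x : pt) : R :=
  \sum_(z \in S `\ x) kern alpha x z.
Definition wt (i : nat) (alpha : R) (S : set pt) (x : pt) : R :=
  match i with
  | 1 => 1
  | 2 => w2 alpha S x
  | _ => Num.max 1 (w2 alpha S x)
  end.
Definition Wt i alpha (S U : set pt) : R := \sum_(x \in U) wt i alpha S x.
Definition Iso i alpha (S U : set pt) : R :=
  (Wt i alpha S U)^-1 * \sum_(x \in U) \sum_(y \in S `\` U) kern alpha x y.

(* isoperimetric profile (inf over the empty set is +oo) and Cheeger constant *)
Definition profile i alpha (S : set pt) (t : R) : \bar R :=
  ereal_inf [set (Iso i alpha S U)%:E | U in
    [set U | [/\ U `<=` S, U !=set0 & Wt i alpha S U <= t * Wt i alpha S S]]].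
Definition cheeger i alpha (S : set pt) : \bar R := profile i alpha S (2^-1).

Definition as_eventually (P : probability Omega R) (E : nat -> config -> Prop) :=
  exists O : set Omega, [/\ measurable O, P O = 1%E &
    forall xi, O xi -> exists L0 : nat, forall L : nat, (L0 <= L)%N -> E L xi].

Definition cube (K : R) (x : Zd) : set pt :=
  [set y | forall i, (x ord0 i)%:~R * K <= y ord0 i < (x ord0 i)%:~R * K + K].

Definition occ (K : R) (x : Zd) (xi : config) : bool :=
  `[< (cpts xi `&` cube K x) !=set0 >].

Definition bern_weight (p : R) n (om : {ffun 'I_n -> bool}) : R :=
  \prod_(k < n) (if om k then p else 1 - p).

Definition increasing_ev n (A : set {ffun 'I_n -> bool}) : Prop :=
  forall om om' : {ffun 'I_n -> bool}, A om -> (forall k, om k ==> om' k) -> A om'.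

(* stochastic domination of i.i.d. Bernoulli(p) by the field sigma, tested on
   increasing events depending on finitely many sites f 0, ..., f (n-1) *)
Definition dominates_bernoulli (P : probability Omega R) (K p : R) : Prop :=
  forall n (f : 'I_n -> Zd), injective f ->
  forall A : set {ffun 'I_n -> bool}, increasing_ev A ->
    ((\sum_(om : {ffun 'I_n -> bool} | `[< A om >]) bern_weight p om)%:E
      <= P [set xi : Omega | A [ffun k => occ K (f k) xi]])%E.

Definition A1 (P : probability Omega R) : Prop :=
  forall p : R, 0 < p < 1 -> exists K : R, 0 < K /\ dominates_bernoulli P K p.

Definition RA (alpha : R) (A : set pt) (xi : config) : \bar R :=
  \esum_(x in cpts xi `&` A) \esum_(y in cpts xi) (kern alpha x y)%:E.

Definition A2 (alpha : R) (P : probability Omega R) : Prop :=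
  forall eps : R, 0 < eps < 1 -> exists C : R,
    as_eventually P (fun L xi => forall x : Zd,
      (cube (L%:R `^ eps) x `&` Lam L) !=set0 ->
      (RA alpha (cube (L%:R `^ eps) x) xi <= (C * L%:R `^ (eps * d%:R))%:E)%E).

End Defs.

(* Main.v *)
(* Rescale so that space is cut into cells of side [K], occupied with probability close to 1, and
   call two cells adjacent when they touch (king moves). A set [U] of points determines the set of
   cells whose representative point lies in [U], and every boundary edge of that set between two
   occupied cells costs [U] a constant. A Peierls argument shows that almost surely every connected
   set of at least log L cells has few empty cells. Hence long contours of a set of cells consist
   mostly of edges between occupied cells, while short contours can be erased by toggling the small
   region that they enclose; contours are connected because 1-cochains mod 2 that vanish on
   triangles are coboundaries. The isoperimetric inequality of the grid then gives a cut of order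
   |U|^((d-1)/d), provided that most of the weight of [U] and of its complement sits in pure boxes
   of side L^e: such boxes are not affected by the erasure. Otherwise many boxes are mixed, and each
   of them contains a pair of points, one in [U] and one outside, at distance O((log L)^(1/d)); as
   alpha < d, such a pair contributes L^(-o(1)), which yields the first term of the minimum.
   Assumption (A2) converts weights into volumes at scale L^e. *)
Require Import Defs.
From HB Require Import structures.
From mathcomp Require Import all_boot all_order all_algebra zify ring lra.
Set Implicit Arguments. Unset Strict Implicit. Unset Printing Implicit Defensive.

(** * Isoperimetry in a box of the king graph *)

(* [lia] does not identify the same ordinal reached through different finType instances. *)
Ltac olia :=
  repeat match goal with |- context [nat_of_ord ?x] =>
    let a := fresh "a" in move: (nat_of_ord x) => a end; lia.

Section Grid.
Variables (d n : nat).

Definition cell := {ffun 'I_d -> 'I_n.+1}.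

(** Sup-norm distance at most [r], written with additions because subtraction on [nat] truncates. At
    [r = 1] it is king adjacency, each cell being adjacent to itself. *)
Definition knear (r : nat) (x y : cell) : bool :=
  [forall i, (x i <= y i + r) && (y i <= x i + r)].

Lemma knearP r (x y : cell) :
  reflect (forall i, x i <= y i + r /\ y i <= x i + r) (knear r x y).
Proof.
apply: (iffP forallP) => h i; first by case/andP: (h i).
by apply/andP; exact: h.
Qed.

Lemma knear_sym r x y : knear r x y = knear r y x.
Proof. by apply/knearP/knearP => h i; case: (h i). Qed.

Lemma knear_refl r x : knear r x x.
Proof. by apply/knearP => i; lia. Qed.

Lemma knear_trans r s y x z : knear r x y -> knear s y z -> knear (r + s) x z.
Proof.
by move=> /knearP h /knearP h'; apply/knearP => i; have := h i; have := h' i; lia.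
Qed.

Lemma knear_leq r s x y : r <= s -> knear r x y -> knear s x y.
Proof. by move=> rs /knearP h; apply/knearP => i; have := h i; lia. Qed.

Definition kball (r : nat) (x : cell) : {set cell} := [set y | knear r x y].

(** Each coordinate moves towards its target at unit speed and then waits. Hence the walk never
    leaves a ball that contains both ends. *)
Definition king (x y : cell) (t : nat) : cell :=
  [ffun i => if x i <= y i then inord (minn (x i + t) (y i))
             else inord (maxn (x i - t) (y i))].

Lemma kingE x y t i : king x y t i =
  (if x i <= y i then minn (x i + t) (y i) else maxn (x i - t) (y i)) :> nat.
Proof.
by rewrite ffunE; have := ltn_ord (x i); have := ltn_ord (y i);
  case: ifP => h hy hx; rewrite inordK; lia.
Qed.

Lemma king0 x y : king x y 0 = x.
Proof. by apply/ffunP => i; apply/val_inj; rewrite /= kingE; case: ifP; lia. Qed.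

Lemma king_end r x y : knear r x y -> king x y r = y.
Proof.
move=> /knearP h; apply/ffunP => i; apply/val_inj; rewrite /= kingE.
by have := h i; case: ifP; lia.
Qed.

Lemma king_step x y t : knear 1 (king x y t) (king x y t.+1).
Proof. by apply/knearP => i; rewrite !kingE; case: ifP; lia. Qed.

Lemma knear_king r x y t z : knear r z x -> knear r z y -> knear r z (king x y t).
Proof.
move=> /knearP hx /knearP hy; apply/knearP => i; rewrite kingE.
by have := hx i; have := hy i; case: ifP; lia.
Qed.

Lemma knear_n x y : knear n x y.
Proof.
by apply/knearP => i; have := ltn_ord (x i); have := ltn_ord (y i); lia.
Qed.

(** The border of the box may cut the ball, but a full cube of side [r.+1] survives: its corner
    [minn (x i) (n - r)] is pushed inwards. *)
Lemma leq_card_kball r x : r <= n -> r.+1 ^ d <= #|kball r x|.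
Proof.
move=> rn.
pose h (o : {ffun 'I_d -> 'I_r.+1}) : cell :=
  [ffun i => inord (minn (x i) (n - r) + o i)].
have hE o i : h o i = minn (x i) (n - r) + o i :> nat.
  by rewrite ffunE inordK //; have := ltn_ord (o i); lia.
have h_inj : injective h.
  move=> o o' eqh; apply/ffunP => i; apply/val_inj => /=.
  by have := hE o i; rewrite eqh hE; lia.
have := card_imset predT h_inj; rewrite cardT /= -cardT card_ffun !card_ord => <-.
apply/subset_leq_card/fintype.subsetP => y /imsetP[o _ ->]; rewrite inE.
apply/knearP => i; rewrite hE.
by have := ltn_ord (o i); have := ltn_ord (x i); olia.
Qed.

Definition bdry (S : {set cell}) : {set cell * cell} :=
  [set e | [&& knear 1 e.1 e.2, e.1 \in S & e.2 \notin S]].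

(* Every pair at distance at most [r] separated by [S] crosses [bdry S] along its king walk, and
   is determined by the crossed edge, the crossing time and the displacement [y - x]. *)
Lemma card_separated r (S : {set cell}) :
  #|[set p : cell * cell | [&& knear r p.1 p.2, p.1 \in S & p.2 \notin S]]|
    <= #|bdry S| * (r.*2.+1 ^ d * r).
Proof.
set P := [set p | _].
(* For radius 0 no pair is separated. Otherwise the crossing times form a nonempty type, in which
   [ord0] can serve as the default of [tm]. *)
case: r => [|r] in P *.
  suff -> : P = set0 by rewrite cards0.
  apply/setP => -[x y]; rewrite !inE /=; apply/negP => /and3P[h xS yS].
  by move: yS; rewrite -(king_end h) king0 xS.
have exit p : p \in P -> exists t : 'I_r.+1,
    (king p.1 p.2 t, king p.1 p.2 t.+1) \in bdry S.
  rewrite inE => /and3P[h xS yS].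
  have ex : exists t, king p.1 p.2 t \notin S by exists r.+1; rewrite king_end.
  case: (ex_minnP ex) => -[|t]; first by rewrite king0 xS.
  move=> tS tmin; have tr : t < r.+1 by have := tmin r.+1; rewrite king_end //; apply.
  exists (Ordinal tr); rewrite inE /= king_step tS andbT /=.
  by apply: contraT => /tmin; rewrite ltnn.
pose tm p : 'I_r.+1 :=
  odflt ord0 [pick t : 'I_r.+1 | (king p.1 p.2 t, king p.1 p.2 t.+1) \in bdry S].
have tmP p : p \in P -> (king p.1 p.2 (tm p), king p.1 p.2 (tm p).+1) \in bdry S.
  move=> /exit[t ht]; rewrite /tm; case: pickP => [//|] /(_ t) /=; first by rewrite ht.
(* The displacement is shifted by the radius to become a natural number. Displacement and time tell
   how far each coordinate has moved, so the position on the walk gives back [x]. *)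
pose code p := ((king p.1 p.2 (tm p), king p.1 p.2 (tm p).+1),
   ([ffun i => inord (p.2 i + r.+1 - p.1 i)] : {ffun 'I_d -> 'I_r.+1.*2.+1}, tm p)).
have code_inj : {in P &, injective code}.
  move=> [x y] [x' y']; rewrite !inE /= => /and3P[/knearP h _ _] /and3P[/knearP h' _ _].
  rewrite /code /=; move: (tm (x, y)) (tm (x', y')) => t t' [ek _ eo et].
  have eoi i : y i + r.+1 - x i = y' i + r.+1 - x' i.
    move/ffunP/(_ i)/(congr1 (@nat_of_ord _)): eo; rewrite !ffunE !inordK //;
    by have := h i; have := h' i; olia.
  have eki i : king x y t i = king x' y' t i :> nat by rewrite ek et.
  have xx i : x i = x' i :> nat.
    have := eoi i; have := eki i; rewrite !kingE; have := h i; have := h' i.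
    by case: ifP; case: ifP; olia.
  congr pair; apply/ffunP => i; apply/val_inj => //=.
  by have := eoi i; have := xx i; have := h i; have := h' i; olia.
rewrite -(card_in_imset code_inj).
have -> : #|bdry S| * (r.+1.*2.+1 ^ d * r.+1) =
   #|setX (bdry S) [set: {ffun 'I_d -> 'I_r.+1.*2.+1} * 'I_r.+1]|.
  by rewrite cardsX cardsT card_prod card_ffun !card_ord.
by apply/subset_leq_card/fintype.subsetP => c /imsetP[p /tmP hp ->]; rewrite in_setX hp in_setT.
Qed.

(** Take the least cube side whose volume is at least twice [#|S|]. Each cell of [S] has at least
    half that volume of cells outside [S] within this distance; counting these pairs with
    [card_separated] bounds [#|S|] by a multiple of the side times the boundary, and the side is of
    order [#|S|^(1/d)]. *)
Lemma isoperimetry (S : {set cell}) : 1 < d -> #|S| <= #|~: S| ->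
  #|S| ^ d.-1 <= (2 ^ (d + 3) * #|bdry S|) ^ d.
Proof.
move=> d1 SSc; have d0 : 0 < d by lia.
have [->|S0] := posnP #|S|; first by rewrite exp0n; lia.
have ex : exists r, 2 * #|S| <= r ^ d.
  by exists (2 * #|S|); rewrite -[X in X <= _]expn1 leq_pexp2l // muln_gt0.
case: (ex_minnP ex) => -[|r] hr rmin; first by rewrite exp0n // in hr; lia.
(* [S] fills at most half of the box, so the chosen cube fits into it. *)
have rn : r.+1 <= n.+1.
  apply: rmin; have := cardsC S; rewrite card_ffun !card_ord; lia.
have r0 : 0 < r by case: (r) hr => [|//]; rewrite exp1n; lia.
(* By minimality the side [r] is too small, and [r.+1 <= 2 * r]. *)
have rS : r.+1 ^ d <= 2 ^ d.+1 * #|S|.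
  have h : r ^ d < 2 * #|S|.
    by rewrite ltnNge; apply/negP => /rmin; rewrite ltnn.
  have : r.+1 ^ d <= (2 * r) ^ d by rewrite leq_exp2r //; lia.
  rewrite expnMn expnS => h2; nia.
have sep : #|S| * (r.+1 ^ d - #|S|) <= #|bdry S| * (r.*2.+1 ^ d * r).
  apply: leq_trans (card_separated r S).
  rewrite -sum_nat_const.
  have -> : #|[set p : cell * cell | [&& knear r p.1 p.2, p.1 \in S & p.2 \notin S]]| =
      \sum_(x in S) #|kball r x :\: S|.
    under eq_bigr do rewrite -sum1_card.
    rewrite pair_big_dep /= sum1dep_card; apply: eq_card => p.
    by rewrite !inE; do !case: (_ \in _); case: knear.
  apply: leq_sum => x xS.
  rewrite leq_subLR (leq_trans (leq_card_kball x rn)) //.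
  by rewrite -(cardsID S (kball r x)) leq_add2r subset_leq_card ?subsetIr.
have lin : #|S| <= 2 ^ d.+1 * r.+1 * #|bdry S|.
  have h : #|bdry S| * (r.*2.+1 ^ d * r) <= #|bdry S| * ((2 ^ d * r.+1 ^ d) * r.+1).
    rewrite leq_mul2l; apply/orP; right; apply: leq_mul => //.
    by rewrite -expnMn leq_exp2r //; lia.
  have p0 : 0 < r.+1 ^ d by rewrite expn_gt0.
  rewrite -(leq_pmul2l p0) expnS.
  have h2 : r.+1 ^ d * #|S| <= 2 * (#|S| * (r.+1 ^ d - #|S|)).
    by rewrite mulnC mulnCA leq_mul2l; apply/orP; right; lia.
  apply: leq_trans h2 _; apply: leq_trans (_ : 2 * (#|bdry S| * (2 ^ d * r.+1 ^ d * r.+1)) <= _).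
    by rewrite leq_mul2l (leq_trans sep h).
  by apply/eq_leq; ring.
rewrite -(leq_pmul2l S0) -expnS prednK //.
apply: leq_trans (_ : (2 ^ d.+1 * r.+1 * #|bdry S|) ^ d <= _).
  by rewrite leq_exp2r.
have -> : 2 ^ (d + 3) = 2 ^ d.+1 * 4 by rewrite addn3 2!expnSr -mulnA.
have e4 : 2 ^ d.+1 <= 4 ^ d by rewrite (_ : 4 = 2 ^ 2) // -expnM leq_exp2l //; lia.
rewrite !expnMn -!mulnA [X in _ <= X]mulnCA leq_mul // mulnA leq_mul //.
by rewrite mulnC (leq_trans rS) // leq_mul.
Qed.

End Grid.

(** * Contours *)

Section Cohomology.
Variables (d n : nat).
Local Notation cell := (cell d n).

Definition mass (x : cell) : nat := \sum_i x i.

(** One step of a discrete contraction of the grid to the origin; [mass] counts the steps that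
    remain. *)
Definition lower (x : cell) : cell :=
  if [pick k : 'I_d | 0 < x k] is Some k0 then
    let k := [arg min_(k < k0 | 0 < x k) (k : nat)] in
    [ffun i => if i == k then inord (x i).-1 else x i]
  else x.

Lemma lowerE (x : cell) (k : 'I_d) : 0 < x k -> (forall i : 'I_d, 0 < x i -> k <= i) ->
  forall i, lower x i = (if i == k then (x i).-1 else x i) :> nat.
Proof.
move=> xk kmin i; rewrite /lower; case: pickP => [k1 xk1|/(_ k)]; last by rewrite xk.
case: arg_minnP => // k' xk' kmin'; have -> : k' = k.
  by apply/val_inj/eqP; rewrite eqn_leq kmin //= kmin'.
rewrite ffunE; case: eqP => // _; rewrite inordK //.
by have := ltn_ord (x i); olia.
Qed.

Lemma mass_lower (x : cell) (k : 'I_d) : 0 < x k ->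
  (forall i : 'I_d, 0 < x i -> k <= i) -> mass x = (mass (lower x)).+1.
Proof.
move=> xk kmin; rewrite /mass (bigD1 k) //= [in RHS](bigD1 k) //=.
rewrite (lowerE xk kmin) eqxx -addSn prednK //; congr addn.
by apply: eq_bigr => i /negPf ik; rewrite (lowerE xk kmin) ik.
Qed.

Lemma knear_lower (x y : cell) (k : 'I_d) : 0 < x k ->
  (forall i : 'I_d, 0 < x i -> k <= i) -> knear 1 x y -> y k <= x k ->
  knear 1 x (lower x) /\ knear 1 (lower x) y.
Proof.
move=> xk kmin /knearP xy yx; split; apply/knearP => i; rewrite (lowerE xk kmin);
by have := xy i; case: eqP => [->|_]; move: xk yx; olia.
Qed.

(* Of two adjacent cells, one can be lowered without leaving the other's neighbourhood:
   look at the first coordinate that is nonzero in either cell, and lower the larger value. *)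
Lemma lower_or (x y : cell) : knear 1 x y -> 0 < mass x + mass y ->
  [/\ knear 1 x (lower x), knear 1 (lower x) y & mass x = (mass (lower x)).+1] \/
  [/\ knear 1 y (lower y), knear 1 (lower y) x & mass y = (mass (lower y)).+1].
Proof.
move=> xy; rewrite -big_split /= lt0n sum_nat_eq0 negb_forall => /existsP[k0].
rewrite negb_imply -lt0n => /andP[_ k0P].
case: (@arg_minnP _ k0 (fun k : 'I_d => 0 < x k + y k) (fun k => k : nat)) => //.
move=> k kP kmin.
have kx i : 0 < x i -> k <= i by move=> xi; apply: kmin; lia.
have ky i : 0 < y i -> k <= i by move=> xi; apply: kmin; lia.
have [yx|/ltnW xy'] := leqP (y k) (x k); [left|right].
  have xk : 0 < x k by lia.
  by have [? ?] := knear_lower xk kx xy yx; split => //; exact: mass_lower kx.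
have yk : 0 < y k by lia.
have yx : knear 1 y x by rewrite knear_sym.
by have [? ?] := knear_lower yk ky yx xy'; split => //; exact: mass_lower ky.
Qed.

(* The clique complex of the king graph is contractible, so closed 1-cochains mod 2 are exact. *)
Lemma cochain_exact (f : cell -> cell -> bool) :
  (forall x y z, knear 1 x y -> knear 1 y z -> knear 1 x z -> f x y (+) f y z = f x z) ->
  exists g : cell -> bool, forall x y, knear 1 x y -> f x y = g x (+) g y.
Proof.
move=> f_closed.
have f_refl x : f x x = false.
  by have := f_closed x x x (knear_refl _ _) (knear_refl _ _) (knear_refl _ _); case: (f x x).
have f_sym x y : knear 1 x y -> f x y = f y x.
  move=> xy; have := f_closed x y x xy; rewrite knear_sym xy knear_refl f_refl.
  by move=> /(_ isT isT); case: (f x y); case: (f y x).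
(* [g] adds up [f] along the successive lowerings of [x] down to the origin. Its first argument is
   fuel, and [mass x] is exactly the length of this path. *)
pose fix g m x {struct m} := if m is m'.+1 then f x (lower x) (+) g m' (lower x) else false.
exists (fun x => g (mass x) x) => x y; have [m] := ubnP (mass x + mass y).
elim: m x y => [//|m IH] x y xym xy.
have [m0|/(lower_or xy)[[xl ly mE]|[yl lx mE]]] := posnP (mass x + mass y).
- have -> : x = y; last by rewrite f_refl addbb.
  apply/ffunP => i; apply/val_inj => /=.
  have [/eqP + /eqP] : mass x = 0 /\ mass y = 0 by lia.
  by rewrite !sum_nat_eq0 => /forallP/(_ i)/eqP-> /forallP/(_ i)/eqP->.
(* The triangle [x], [lower x], [y] trades the edge from [x] to [y] for the edge from [lower x] to
   [y], of smaller total mass. *)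
- rewrite mE /= -addbA -IH //; last by move: xym; rewrite mE; lia.
  by rewrite f_closed.
- rewrite mE /= addbCA -IH; first last.
  + by rewrite knear_sym.
  + by move: xym; rewrite mE; lia.
  by rewrite (f_sym x y) // (f_sym x) 1?knear_sym // f_closed // knear_sym.
Qed.

End Cohomology.

Section Contours.
Variables (d n : nat).
Local Notation cell := (cell d n).
Implicit Types (S T V Q A : {set cell}) (x y z : cell).

Definition inside V : rel cell := [rel x y | [&& x \in V, y \in V & knear 1 x y]].

Definition kconnected V := forall x y, x \in V -> y \in V -> connect (inside V) x y.

Lemma inside_sym V : connect_sym (inside V).
Proof.
apply: sym_connect_sym => x y; rewrite /inside /= knear_sym.
by rewrite andbCA.
Qed.

Lemma kconnected_kball r x : kconnected (kball r x).
Proof.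
move=> y z; rewrite !inE => xy xz.
suff conn t : connect (inside (kball r x)) y (king y z t).
  by have := conn n; rewrite king_end // knear_n.
elim: t => [|t IH]; first by rewrite king0.
apply: connect_trans IH _; apply: connect1; rewrite /inside /= !inE king_step.
by rewrite !knear_king.
Qed.

Lemma kconnected_setT : kconnected setT.
Proof.
move=> x y _ _; have -> : setT = kball n x by apply/setP => z; rewrite !inE knear_n.
by apply: kconnected_kball; rewrite inE knear_n.
Qed.

Lemma kconnected_const V (g : cell -> bool) : kconnected V ->
  (forall x y, x \in V -> y \in V -> knear 1 x y -> g x = g y) ->
  forall x y, x \in V -> y \in V -> g x = g y.
Proof.
move=> Vc gV x y xV yV.
have cl : closed (inside V) [pred z | g z].
  by move=> a b /and3P[aV bV ab]; rewrite !inE /= (gV a b).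
exact: (closed_connect cl (Vc x y xV yV)).
Qed.

(** For [x] outside [T] this is the singleton of [x], so the inclusion in [T] needs [x \in T]. *)
Definition kcomponent T x : {set cell} := [set y | connect (inside T) x y].

Lemma kcomponent_sub T x : x \in T -> kcomponent T x \subset T.
Proof.
move=> xT; apply/subsetP => y; rewrite inE => xy.
have cl : closed (inside T) (mem T) by move=> a b /and3P[aT bT _]; rewrite aT bT.
by rewrite -(closed_connect cl xy).
Qed.

Lemma kconnected_component T x : x \in T -> kconnected (kcomponent T x).
Proof.
move=> xT y z; rewrite !inE => xy xz.
set C := kcomponent T x.
have yC : y \in C by rewrite inE.
have Csub : closed (inside C) (mem C) by move=> a b /and3P[aC bC _]; rewrite aC bC.
have cl : closed (inside T) [pred z | connect (inside C) y z].
  apply: (intro_closed (@inside_sym T)) => a b ab; rewrite !inE => ya.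
  apply: (connect_trans ya (connect1 _)).
  have aC : a \in C by rewrite -(closed_connect Csub ya).
  have [aT bT ab1] := and3P ab; rewrite /inside /= aC ab1 andbT inE.
  by apply: connect_trans (connect1 ab); rewrite inE in aC.
have yz : connect (inside T) y z by apply: connect_trans xz; rewrite inside_sym.
by have := closed_connect cl yz; rewrite !inE connect0.
Qed.

Lemma card_component_partition T (g : cell -> nat) :
  \sum_(x in T) g x =
  \sum_(C in [set kcomponent T x | x in T]) \sum_(x in C) g x.
Proof.
have eqR : {in T & &, equivalence_rel (connect (inside T))}.
  move=> x y z _ _ _; split; first exact: connect0.
  by move=> xy; exact: (same_connect (@inside_sym T) xy z).
have /and3P[/eqP cov triv _] := equivalence_partitionP eqR.
have -> : [set kcomponent T x | x in T] = equivalence_partition (connect (inside T)) T.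
  apply: eq_in_imset => x xT; apply/setP => y; rewrite !inE.
  apply/idP/andP => [xy|[]//]; split => //.
  by apply: (subsetP (kcomponent_sub xT)); rewrite inE.
by rewrite -(big_trivIset _ triv) cov.
Qed.

Lemma leq_card_kball1 x : #|kball 1 x| <= 3 ^ d.
Proof.
pose o y : {ffun 'I_d -> 'I_3} := [ffun i => inord (y i + 1 - x i)].
have o_inj : {in kball 1 x &, injective o}.
  move=> y y'; rewrite !inE => /knearP h /knearP h' /ffunP eqo.
  apply/ffunP => i; apply/val_inj => /=; have := congr1 (@nat_of_ord _) (eqo i).
  by rewrite !ffunE !inordK; have := h i; have := h' i; olia.
rewrite -(card_in_imset o_inj) (leq_trans (max_card _)) //.
by rewrite card_ffun !card_ord.
Qed.

(** Both ends of every separated edge belong to it, so a separated edge with one end in a component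
    of the contour lies wholly in that component. *)
Definition contour S : {set cell} :=
  [set x | [exists y, knear 1 x y && ((x \in S) != (y \in S))]].

Lemma card_contour S : #|contour S| <= 2 * #|bdry S|.
Proof.
have sub : contour S \subset [set e.1 | e in bdry S] :|: [set e.2 | e in bdry S].
  apply/subsetP => x; rewrite !inE => /existsP[y /andP[xy]].
  have [xS|xS] := boolP (x \in S) => yS.
    by apply/orP; left; apply/imsetP; exists (x, y); rewrite // inE /= xy xS; case: (y \in S) yS.
  by apply/orP; right; apply/imsetP; exists (y, x); rewrite // inE /= knear_sym xy xS; case: (y \in S) yS.
apply: leq_trans (subset_leq_card sub) _; apply: leq_trans (leq_card_setU _ _) _.
by rewrite mul2n -addnn leq_add // leq_imset_card.
Qed.

Lemma card_edges_at T (E : {set cell * cell}) :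
  (forall e, e \in E -> e.1 \in T /\ knear 1 e.1 e.2) -> #|E| <= #|T| * 3 ^ d.
Proof.
move=> ET; apply: (@leq_trans (\sum_(x in T) #|kball 1 x|)); last first.
  by rewrite -sum_nat_const leq_sum // => x _; exact: leq_card_kball1.
under eq_bigr do rewrite -sum1_card.
rewrite pair_big_dep /= sum1dep_card; apply/subset_leq_card/subsetP => e /ET[eT ee].
by rewrite !inE eT.
Qed.

(* Toggling [S] on the small side of a short component of its contour deletes that component,
   so an [S] minimizing the boundary has long components only. *)
Lemma long_contours A (F : {set {set cell}}) h m0 : 1 < d ->
  (forall Q, Q \in F -> [/\ kconnected Q, h <= #|Q| &
     forall x y, x \in Q -> y \in Q -> (x \in A) = (y \in A)]) ->
  (2 ^ (d + 3) * (m0 * 3 ^ d)) ^ d < h ->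
  exists S, [/\ forall x y, knear 1 x y -> (x \in S) != (y \in S) -> (x \in A) != (y \in A),
    forall Q x, Q \in F -> x \in Q -> (x \in S) = (x \in A) &
    forall x, x \in contour S -> m0 <= #|kcomponent (contour S) x|].
Proof.
move=> d1 FP hm.
(* The competitors of [A]: they separate only adjacent cells that [A] separates, and they agree with
   [A] on the members of [F]. *)
pose P S := [forall x, forall y, knear 1 x y ==> ((x \in S) != (y \in S)) ==>
    ((x \in A) != (y \in A))] && [forall Q in F, forall x in Q, (x \in S) == (x \in A)].
have PA : P A.
  apply/andP; split; first by apply/forallP => x; apply/forallP => y; rewrite implybb implybT.
  by apply/forall_inP => Q _; apply/forall_inP => x _.
pose E S := [set e : cell * cell | knear 1 e.1 e.2 && ((e.1 \in S) != (e.2 \in S))].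
case: (arg_minnP (fun S => #|E S|) PA) => S /andP[/forallP SA /forall_inP SF] Smin.
have {}SA x y : knear 1 x y -> (x \in S) != (y \in S) -> (x \in A) != (y \in A).
  by move=> xy xyS; have /forallP/(_ y) := SA x; rewrite xy xyS.
have {}SF Q x : Q \in F -> x \in Q -> (x \in S) = (x \in A).
  by move=> QF xQ; apply/eqP; exact: (forall_inP (SF Q QF)).
exists S; split => // x0 x0S; rewrite leqNgt; apply/negP => small.
set C := kcomponent _ _ in small.
(* The coboundary of [S] mod 2, restricted to the component [C]. By [CS] a separated edge that meets
   [C] lies in [C], so [f] still vanishes on triangles. *)
pose f x y := [&& x \in C, y \in C & (x \in S) (+) (y \in S)].
have CS x y : knear 1 x y -> (x \in C) && ((x \in S) != (y \in S)) ==> (y \in C).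
  move=> xy; apply/implyP => /andP[]; rewrite !inE => x0x xyS.
  apply: (connect_trans x0x (connect1 _)).
  rewrite /inside /= xy andbT !inE; apply/andP; split; apply/existsP.
    by exists y; rewrite xy.
  by exists x; rewrite knear_sym xy eq_sym.
have [g gE] : exists g : cell -> bool, forall x y, knear 1 x y -> f x y = g x (+) g y.
  apply: cochain_exact => x y z xy yz xz.
  have := CS x y xy; have := CS y z yz; have := CS x z xz; rewrite knear_sym in xz.
  have := CS z x xz; rewrite knear_sym in xy; have := CS y x xy.
  rewrite knear_sym in yz; have := CS z y yz; rewrite /f.
  by do !case: (_ \in _).
pose G b := [set x | g x == b].
(* The two level sets of [g] are the two sides of [C]; the smaller one is the region to toggle. *)
have [b Gb] : exists b, #|G b| <= #|~: G b|.
  have GC : ~: G true = G false by apply/setP => x; rewrite !inE; case: (g x).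
  have [GT|/ltnW GT] := leqP #|G true| #|~: G true|; first by exists true.
  by exists false; rewrite -GC setCK.
have bdG : #|bdry (G b)| <= m0 * 3 ^ d.
  apply: leq_trans (_ : #|C| * 3 ^ d <= _); last by rewrite leq_mul2r ltnW // orbT.
  apply: card_edges_at => -[x y]; rewrite !inE /= => /and3P[xy /eqP gx gy].
  have : f x y by rewrite gE // gx; case: b (g y) gy {Gb gx} => -[].
  by rewrite /f xy inE => /and3P[].
(* Since [d.-1 >= 1], isoperimetry turns the short boundary into a bound on the volume itself. *)
have Gh : #|G b| < h.
  apply: leq_ltn_trans hm; apply: leq_trans (_ : #|G b| ^ d.-1 <= _).
    have [->//|G0] := posnP #|G b|.
    by rewrite -[X in X <= _]expn1 leq_pexp2l //; lia.
  apply: leq_trans (isoperimetry d1 Gb) _.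
  by rewrite leq_exp2r ?leq_mul2l ?bdG ?orbT //; lia.
have EE T u v : ((u, v) \in E T) = knear 1 u v && ((u \in T) != (v \in T)) by rewrite inE.
pose S' := [set x | (x \in S) (+) (x \in G b)].
have S'E x y : knear 1 x y ->
    ((x \in S') != (y \in S')) = ((x \in S) != (y \in S)) && ~~ f x y.
  move=> xy; rewrite !inE gE //.
  by have := gE _ _ xy; rewrite /f; case: b {Gb bdG Gh S'}; do !case: (_ \in _);
    case: (g x); case: (g y).
have PS' : P S'.
  apply/andP; split.
    apply/forallP => x; apply/forallP => y; apply/implyP => xy; apply/implyP.
    by rewrite S'E // => /andP[+ _]; apply: SA.
  apply/forall_inP => Q QF; apply/forall_inP => x xQ.
  have [Qc hQ QA] := FP Q QF.
  (* On [Q] the set [S] agrees with [A], which is constant there; no edge of [Q] is separated, so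
     [g] is constant on [Q]. If [Q] met [G b] it would be contained in it, but it is too large. *)
  have gQ : forall y, y \in Q -> g x = g y.
    move=> y yQ; apply: (kconnected_const Qc) => // u v uQ vQ uv.
    apply/eqP; rewrite -negb_add -gE // /f (SF Q) // (SF Q v) // (QA u v) // addbb.
    by rewrite !andbF.
  rewrite -(SF Q x QF xQ) inE; suff /negPf-> : x \notin G b by rewrite addbF.
  apply/negP => xG; have : #|Q| <= #|G b|.
    apply/subset_leq_card/subsetP => y yQ; rewrite inE -gQ //.
    by rewrite inE in xG.
  by rewrite leqNgt (leq_trans Gh).
(* Toggling removes every separated edge inside [C], at least one of which starts at [x0], and
   creates none; this contradicts minimality. *)
have := Smin S' PS'; rewrite leqNgt => /negP; apply.
apply/proper_card/properP; split.
  by apply/subsetP => -[x y]; rewrite !EE => /andP[xy]; rewrite xy S'E // => /andP[].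
have [y xy xyS] : exists2 y, knear 1 x0 y & (x0 \in S) != (y \in S).
  by move: x0S; rewrite inE => /existsP[y /andP[]]; exists y.
exists (x0, y); rewrite EE xy ?S'E //= xyS /=.
have x0C : x0 \in C by rewrite inE connect0.
have := CS x0 y xy; rewrite x0C xyS /= => yC.
by rewrite negbK /f x0C yC; move: xyS; case: (x0 \in S); case: (y \in S).
Qed.

End Contours.

(** * Isoperimetry with edges between occupied cells *)

Section Percolation.
Variables (d n : nat) (Z : {set cell d n}) (m0 : nat).
Local Notation cell := (cell d n).
Implicit Types (S T V Q A : {set cell}) (x y z : cell).

Hypothesis d1 : 1 < d.
(* [Z] is the set of empty cells. *)
Hypothesis sparse : forall V, kconnected V -> m0 <= #|V| ->
  8 * 3 ^ d * #|V :&: Z| <= #|V|.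

Definition open_bdry A : {set cell * cell} :=
  [set e in bdry A | (e.1 \notin Z) && (e.2 \notin Z)].

Definition eswap (e : cell * cell) := (e.2, e.1).

Lemma eswap_inj : injective eswap.
Proof. by move=> [x y] [x' y'] [-> ->]. Qed.

Lemma card_bdryC S : #|bdry (~: S)| <= #|bdry S|.
Proof.
rewrite -(card_imset (bdry (~: S)) eswap_inj); apply/subset_leq_card/subsetP => e.
move=> /imsetP[[x y]]; rewrite !inE /= => /and3P[xy xS yS] -> /=.
by rewrite knear_sym xy xS -[y \in S]negbK yS.
Qed.

Lemma sparse_contour S : (forall x, x \in contour S -> m0 <= #|kcomponent (contour S) x|) ->
  8 * 3 ^ d * #|contour S :&: Z| <= #|contour S|.
Proof.
move=> long.
have cardI (T : {set cell}) : #|T :&: Z| = \sum_(x in T) (x \in Z : nat).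
  rewrite -sum1_card [RHS](eq_bigr (fun x => if x \in Z then 1 else 0)).
    by rewrite -big_mkcondr; apply: eq_bigl => x; rewrite inE.
  by move=> x _; case: (x \in Z).
rewrite cardI -[X in _ <= X]sum1_card !card_component_partition big_distrr /=.
apply: leq_sum => _ /imsetP[x xS ->].
by rewrite -cardI sum1_card (sparse (kconnected_component xS) (long x xS)).
Qed.

(** At most [2 * 3 ^ d * #|contour S :&: Z|] boundary edges have an empty end. By sparsity this is
    at most a quarter of the contour, hence at most half of the boundary. *)
Lemma card_bdry_open S : (forall x, x \in contour S -> m0 <= #|kcomponent (contour S) x|) ->
  #|bdry S| <= 2 * #|open_bdry S|.
Proof.
move=> /sparse_contour sp.
pose E1 := [set e in bdry S | e.1 \in Z]; pose E2 := [set e in bdry S | e.2 \in Z].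
have sub : bdry S \subset open_bdry S :|: (E1 :|: E2).
  apply/subsetP => e; rewrite !inE => ->.
  by case: (e.1 \in Z); case: (e.2 \in Z).
have cE1 : #|E1| <= #|contour S :&: Z| * 3 ^ d.
  apply: card_edges_at => -[x y]; rewrite !inE /= => /andP[/and3P[xy xS yS] xZ].
  split=> //; rewrite xZ andbT; apply/existsP; exists y.
  by rewrite xy xS (negPf yS).
have cE2 : #|E2| <= #|contour S :&: Z| * 3 ^ d.
  rewrite -(card_imset E2 eswap_inj); apply: card_edges_at => _ /imsetP[[x y] + ->].
  rewrite !inE /= => /andP[/and3P[xy xS yS] xZ]; rewrite knear_sym in xy.
  split=> //; rewrite xZ andbT; apply/existsP; exists x.
  by rewrite xy xS (negPf yS).
have cb : #|bdry S| <= #|open_bdry S| + (#|E1| + #|E2|).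
  apply: leq_trans (subset_leq_card sub) (leq_trans (leq_card_setU _ _) _).
  by rewrite leq_add2l leq_card_setU.
have := leq_trans sp (card_contour S); rewrite -mulnA [3 ^ d * _]mulnC.
by move: cE1 cE2 cb; move: (_ * 3 ^ d) => t; lia.
Qed.

(** The set [S] given by [long_contours] contains the members of [F] inside [A] and avoids those
    outside, so both [S] and its complement are at least as large as the minimum on the left. Its
    boundary is mostly open, and its edges are boundary edges of [A]. *)
Lemma percolation_isoperimetry A (F : {set {set cell}}) h :
  (forall Q, Q \in F -> [/\ kconnected Q, h <= #|Q| &
     forall x y, x \in Q -> y \in Q -> (x \in A) = (y \in A)]) ->
  (2 ^ (d + 3) * (m0 * 3 ^ d)) ^ d < h ->
  minn #|cover [set Q in F | Q \subset A]| #|cover [set Q in F | Q \subset ~: A]| ^ d.-1 <=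
    (2 ^ (d + 5) * #|open_bdry A|) ^ d.
Proof.
move=> FP hm; have [S [SA SF long]] := long_contours d1 FP hm.
(* An edge leaving [S] may enter [A], hence the swapped copy and the factor 2. *)
have opS : #|open_bdry S| <= 2 * #|open_bdry A|.
  have sub : open_bdry S \subset open_bdry A :|: [set eswap e | e in open_bdry A].
    apply/subsetP => -[x y]; rewrite in_setU !inE /= => /andP[/and3P[xy xS yS] xyZ].
    have := SA x y xy; rewrite xS (negPf yS) => /(_ isT).
    have [xA yA|xA] := boolP (x \in A).
      by rewrite xy xyZ; case: (y \in A) yA.
    case yA: (y \in A) => // _; apply/orP; right; apply/imsetP; exists (y, x) => //.
    by rewrite !inE /= knear_sym xy yA xA /= andbC.
  have := leq_trans (subset_leq_card sub) (leq_card_setU _ _).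
  by rewrite card_imset ?addnn ?mul2n //; exact: eswap_inj.
have bdS : 2 ^ (d + 3) * #|bdry S| <= 2 ^ (d + 5) * #|open_bdry A|.
  rewrite (_ : d + 5 = d + 3 + 2); last by lia.
  rewrite [X in _ <= X * _]expnD -mulnA; apply: leq_mul => //.
  by apply: leq_trans (card_bdry_open long) _; rewrite -[2 ^ 2]/(2 * 2) -mulnA leq_mul2l.
have c1 : #|cover [set Q in F | Q \subset A]| <= #|S|.
  apply/subset_leq_card/subsetP => x /bigcupP[Q]; rewrite inE => /andP[QF QA] xQ.
  by rewrite (SF Q x QF xQ) (subsetP QA).
have c2 : #|cover [set Q in F | Q \subset ~: A]| <= #|~: S|.
  apply/subset_leq_card/subsetP => x /bigcupP[Q]; rewrite inE => /andP[QF QA] xQ.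
  by rewrite inE (SF Q x QF xQ); have := subsetP QA x xQ; rewrite inE.
have mono a b : a <= b -> a ^ d.-1 <= b ^ d.-1 by move=> ab; rewrite leq_exp2r //; lia.
have d0 : 0 < d by lia.
have [SS|/ltnW SS] := leqP #|S| #|~: S|.
  apply: leq_trans (mono _ #|S| _) _; first by rewrite geq_min c1.
  by apply: leq_trans (isoperimetry d1 SS) _; rewrite leq_exp2r.
apply: leq_trans (mono _ #|~: S| _) _; first by rewrite geq_min c2 orbT.
rewrite -{2}[S]setCK in SS.
apply: leq_trans (isoperimetry d1 SS) _; rewrite leq_exp2r //.
by apply: leq_trans bdS; rewrite leq_mul2l card_bdryC orbT.
Qed.

End Percolation.

(** * Counting connected sets of cells *)

Section Animals.
Variables (d n : nat).
Local Notation cell := (cell d n).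
Local Notation dir := {ffun 'I_d -> 'I_3}.
Implicit Types (V W : {set cell}) (x y : cell).

(** The entries 0, 1, 2 of [o] stand for -1, 0, 1. A step out of the grid lands on an arbitrary
    cell; what matters is that every neighbour is reached. *)
Definition kstep x (o : dir) : cell := [ffun i => inord (x i + o i - 1)].

Lemma kstep_near x y : knear 1 x y -> exists o, kstep x o = y.
Proof.
move=> /knearP xy; exists [ffun i => inord (y i + 1 - x i)].
apply/ffunP => i; apply/val_inj; rewrite /= !ffunE !inordK; have := xy i;
by have := ltn_ord (y i); olia.
Qed.

Definition visited x (s : seq dir) : {set cell} := [set y in x :: scanl kstep x s].

Lemma visited_split x s y : y \in visited x s ->
  exists s1 s2, s = s1 ++ s2 /\ foldl kstep x s1 = y.
Proof.
elim: s x => [|o s IH] x; rewrite inE /= in_cons.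
  by rewrite orbF => /eqP->; exists [::], [::].
case/orP => [/eqP->|ys]; first by exists [::], (o :: s).
have [|s1 [s2 [-> <-]]] := IH (kstep x o); first by rewrite inE.
by exists (o :: s1), s2.
Qed.

(** A detour from [y] to [z] and back is inserted at a visit to [y]; the rest of the walk is
    unchanged. *)
Lemma visited_grow x s y z : y \in visited x s -> knear 1 y z ->
  exists s', size s' = (size s).+2 /\ visited x s' = z |: visited x s.
Proof.
move=> /visited_split[s1 [s2 [-> <-]]] yz.
have [o oE] := kstep_near yz; rewrite knear_sym in yz; have [o' o'E] := kstep_near yz.
exists (s1 ++ [:: o, o' & s2]); split; first by rewrite !size_cat /= !addnS.
have lastE : foldl kstep x s1 \in x :: scanl kstep x s1.
  elim: s1 x {yz oE o'E} => [|a s1 IH] x; first by rewrite /= mem_head.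
  by rewrite /= inE IH orbT.
apply/setP => w; rewrite !inE !scanl_cat /= oE o'E !mem_cat !inE.
have [->|wy] := eqVneq w (foldl kstep x s1); last first.
  by case: (w == x); case: (w == z); case: (w \in scanl _ _ s1).
by move: lastE; rewrite inE => /orP[->|->]; rewrite ?orbT.
Qed.

Lemma kconnected_visited V x m : kconnected V -> x \in V -> m < #|V| ->
  exists s, [/\ size s = m.*2, visited x s \subset V & #|visited x s| = m.+1].
Proof.
move=> Vc xV; elim: m => [|m IH] mV.
  exists [::]; split=> //; last by apply: etrans (cards1 x); apply: eq_card => y; rewrite !inE.
  by apply/subsetP => y; rewrite !inE => /eqP->.
have [s [szs sV cs]] := IH (ltnW mV).
(* Otherwise the trace of the walk is closed under adjacency in [V], so it contains [V], which has
   more cells. *)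
have [y [z [ys zV zs yz]]] : exists y z, [/\ y \in visited x s, z \in V,
    z \notin visited x s & knear 1 y z].
  have [/existsP[y /existsP[z /and4P[]]]|no] := boolP [exists y, exists z,
    [&& y \in visited x s, z \in V, z \notin visited x s & knear 1 y z]].
    by exists y, z.
  suff /subset_leq_card : V \subset visited x s by rewrite cs leqNgt mV.
  have xs : x \in visited x s by rewrite !inE eqxx.
  apply/subsetP => y yV.
  have cl : closed (inside V) (mem (visited x s)).
    apply: (intro_closed (@inside_sym _ _ V)) => a b /and3P[aV bV ab] aW.
    apply: contraR no => bW; apply/existsP; exists a; apply/existsP; exists b.
    by rewrite aW bV bW ab.
  by have := closed_connect cl (Vc x y xV yV); rewrite xs => /esym.
have [s' [szs' vs']] := visited_grow ys yz.
exists s'; rewrite szs' szs vs' cardsU1 zs cs; split=> //.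
by apply/subsetP => w; rewrite in_setU1 => /orP[/eqP->//|/(subsetP sV)].
Qed.

(** A connected set of [m.+1] cells is the trace of a walk of [m.*2] steps, so a starting cell and a
    word of directions determine it. *)
Lemma card_animals (E : {set {set cell}}) m :
  (forall V, V \in E -> kconnected V /\ #|V| = m.+1) ->
  #|E| <= n.+1 ^ d * (3 ^ d) ^ m.*2.
Proof.
move=> EP.
pose code (c : cell * m.*2.-tuple dir) := visited c.1 c.2.
have sub : E \subset [set code c | c in setT].
  apply/subsetP => V /EP[Vc Vm].
  have [x xV] : exists x, x \in V by apply/card_gt0P; rewrite Vm.
  have [|s [szs sV sm]] := kconnected_visited (m := m) Vc xV; first by rewrite Vm.
  have szs' : size s == m.*2 by rewrite szs.
  apply/imsetP; exists (x, Tuple szs') => //.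
  by apply/esym/eqP; rewrite eqEcard sV /= Vm sm.
apply: leq_trans (subset_leq_card sub) (leq_trans (leq_imset_card _ _) _).
by rewrite cardsT card_prod card_tuple !card_ffun !card_ord.
Qed.

End Animals.

(** * From cells to points *)

Import Order.TTheory GRing.Theory Num.Theory.

Section Points.
Local Open Scope ring_scope.
Variables (R : realFieldType) (d n : nat) (T : finType).
Variables (w : T -> R) (k : T -> T -> R).
(* [jc t] is a grid cell close to the point [t]; [rep x] is a point close to the cell [x],
   and in the cell [x] unless [x] belongs to the set [Z] of empty cells. *)
Variables (jc : T -> cell d n) (rep : cell d n -> T) (Z : {set cell d n}).
Variables (m0 s b : nat) (kappa c0 mu : R).
Local Notation cell := (cell d n).
Implicit Types (U G : {set T}) (x y : cell) (u v : T).

Hypothesis d1 : (1 < d)%N.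
Hypothesis sn : (s <= n)%N.
Hypothesis w_ge0 : forall t, 0 <= w t.
Hypothesis k_ge0 : forall t u, 0 <= k t u.
Hypothesis k_sym : forall t u, k t u = k u t.
Hypothesis kappa_ge0 : 0 <= kappa.
Hypothesis mu_ge0 : 0 <= mu.
Hypothesis local_mass : forall v, \sum_(u | knear (s.*2 + b) (jc u) (jc v)) w u <= mu.
Hypothesis jc_rep : forall x, knear b x (jc (rep x)).
Hypothesis k_jc : forall u, kappa <= k u (rep (jc u)).
Hypothesis k_adj : forall x y, knear 1 x y -> kappa <= k (rep x) (rep y).
Hypothesis k_open : forall x y, x \notin Z -> y \notin Z -> knear 1 x y ->
  c0 <= k (rep x) (rep y).
Hypothesis rep_inj : {in ~: Z &, injective rep}.

Definition edge_cut U : R := \sum_(u in U) \sum_(v in ~: U) k u v.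
Definition total_weight U : R := \sum_(u in U) w u.

Lemma edge_cutC U : edge_cut (~: U) = edge_cut U.
Proof.
rewrite /edge_cut setCK exchange_big /=; apply: eq_bigr => u _.
by apply: eq_bigr => v _; exact: k_sym.
Qed.

Definition cells_of U : {set cell} := [set x | rep x \in U].

(** The points in the middle of a pure box; the boxes around them are the sets that the erasure of
    contours respects. *)
Definition deep U : {set T} := [set u in U | kball s (jc u) \subset cells_of U].

Lemma cells_ofC U : cells_of (~: U) = ~: cells_of U.
Proof. by apply/setP => x; rewrite !inE. Qed.

Definition exposed U : {set T} := [set u in U | [exists v in ~: U, kappa <= k u v]].

Lemma card_exposed U : kappa * #|exposed U|%:R <= edge_cut U.
Proof.
rewrite mulr_natr -sumr_const /edge_cut [leRHS](bigID (mem (exposed U))) /= ler_wpDr //.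
  by apply: sumr_ge0 => u _; apply: sumr_ge0.
rewrite [leRHS](eq_bigl (mem (exposed U))) => [|u]; last by rewrite !inE; case: (u \in U).
apply: ler_sum => u; rewrite inE => /andP[_ /existsP[v /andP[vU kv]]].
by rewrite (bigD1 v) //= ler_wpDr // sumr_ge0.
Qed.

(** Either the representative of the cell of [u] lies outside [U], which exposes [u] itself, or the
    ball, being connected, contains two adjacent cells with representatives on opposite sides. *)
Lemma not_deep U u : u \in U :\: deep U ->
  exists2 v, v \in exposed U & knear (s.*2 + b) (jc u) (jc v).
Proof.
rewrite !inE negb_and => /andP[/orP[/negP//|bad] uU].
have [jA|jA] := boolP (jc u \in cells_of U); last first.
  exists u; last exact: knear_refl.
  rewrite inE uU; apply/existsP; exists (rep (jc u)).
  by rewrite k_jc andbT inE; move: jA; rewrite inE.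
have [x [y [xA yA xy ux]]] : exists x y, [/\ x \in cells_of U, y \notin cells_of U,
    knear 1 x y & knear s (jc u) x].
  have [/existsP[x /existsP[y /and4P[? ? ? ?]]]|no] := boolP [exists x, exists y,
    [&& x \in cells_of U, y \notin cells_of U, knear 1 x y & knear s (jc u) x]].
    by exists x, y.
  case/negP: bad; apply/subsetP => y yB.
  have uB : jc u \in kball s (jc u) by rewrite inE knear_refl.
  suff -> : (y \in cells_of U) = (jc u \in cells_of U) by [].
  apply: (kconnected_const (g := fun x => x \in cells_of U) (@kconnected_kball _ _ s (jc u))) => //.
  move=> x z xB zB xz; rewrite inE in xB; rewrite inE in zB; apply/idP/idP => h; apply: contraT => h'.
    by case/negP: no; apply/existsP; exists x; apply/existsP; exists z; rewrite h h' xz.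
  case/negP: no; apply/existsP; exists z; apply/existsP; exists x.
  by rewrite h h' knear_sym xz.
rewrite inE in xA; rewrite inE in yA.
exists (rep x).
  by rewrite inE xA; apply/existsP; exists (rep y); rewrite inE yA k_adj.
by apply: knear_leq (knear_trans ux (jc_rep x)); lia.
Qed.

(** Points that are not deep are charged to a nearby exposed point, which receives weight at most
    [mu] and contributes at least [kappa] to the cut. *)
Lemma weight_not_deep U : kappa * total_weight (U :\: deep U) <= mu * edge_cut U.
Proof.
have h : total_weight (U :\: deep U) <= \sum_(v in exposed U) mu.
  apply: le_trans (_ : \sum_(v in exposed U)
    \sum_(u | knear (s.*2 + b) (jc u) (jc v)) w u <= _); last exact: ler_sum.
  rewrite (exchange_big_dep predT) //= /total_weight [leLHS]big_mkcond /=; apply: ler_sum => u _.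
  case: ifP => [/not_deep[v vE uv]|_]; last by apply: sumr_ge0.
  by rewrite (bigD1 v) ?vE //= ler_wpDr // sumr_ge0.
rewrite sumr_const -mulr_natr in h.
apply: le_trans (ler_wpM2l kappa_ge0 h) _.
by rewrite mulrCA ler_wpM2l // card_exposed.
Qed.

(** Pairs of a point and a cell of its ball are counted in two ways. Points whose balls share a cell
    have cells within [s.*2] of each other, so each cell receives weight at most [mu]. *)
Lemma double_counting G :
  (s.+1 ^ d)%:R * total_weight G <= mu * #|\bigcup_(u in G) kball s (jc u)|%:R.
Proof.
set C := \bigcup_(u in G) _.
apply: (@le_trans _ _ (\sum_(u in G) \sum_(x in kball s (jc u)) w u)).
  rewrite /total_weight mulr_sumr; apply: ler_sum => u _.
  by rewrite sumr_const -[leRHS]mulr_natl ler_wpM2r // ler_nat leq_card_kball.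
rewrite (exchange_big_dep (mem C)) /=; last first.
  by move=> u x uG xB; apply/bigcupP; exists u.
rewrite mulr_natr -sumr_const; apply: ler_sum => x /bigcupP[v vG xv].
apply: le_trans (local_mass v); rewrite [leLHS]big_mkcond [leRHS]big_mkcond /=.
apply: ler_sum => u _; case: ifP => [/andP[_ xu]|_]; last by case: ifP.
rewrite !inE in xu xv; rewrite knear_sym in xv.
by rewrite (knear_leq _ (knear_trans xu xv)) //; lia.
Qed.

Lemma card_open_bdry U : 0 <= c0 -> c0 * #|open_bdry Z (cells_of U)|%:R <= edge_cut U.
Proof.
move=> c00; rewrite mulr_natr -sumr_const /edge_cut.
apply: (@le_trans _ _ (\sum_(e in open_bdry Z (cells_of U)) k (rep e.1) (rep e.2))).
  apply: ler_sum => -[x y]; rewrite !inE /= => /andP[/and3P[xy _ _] /andP[xZ yZ]].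
  exact: k_open.
pose f (e : cell * cell) := (rep e.1, rep e.2).
have f_inj : {in open_bdry Z (cells_of U) &, injective f}.
  move=> [x y] [x' y']; rewrite !inE /= => /andP[_ /andP[xZ yZ]] /andP[_ /andP[xZ' yZ']].
  by case=> /(rep_inj _ _)-> => [/(rep_inj _ _)->||]; rewrite ?inE ?xZ ?yZ ?xZ' ?yZ'.
rewrite pair_big_dep /= -(big_imset (fun p => k p.1 p.2) f_inj) /=.
rewrite [leRHS]big_mkcond [leLHS]big_mkcond /=; apply: ler_sum => -[u v] _ /=.
case: ifP => [|_]; last by case: ifP.
case/imsetP => -[x y]; rewrite !inE /= => /andP[/and3P[_ xU yU] _] [-> ->].
by rewrite xU yU.
Qed.

Hypothesis sparse : forall V, kconnected V -> (m0 <= #|V|)%N ->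
  (8 * 3 ^ d * #|V :&: Z| <= #|V|)%N.
Hypothesis s_large : (2 ^ (d + 3) * (m0 * 3 ^ d) <= s)%N.

(** If the deep part of [U] or of its complement weighs less than half of [U], [weight_not_deep]
    gives the first alternative. Otherwise the balls around deep points form the family [F]; [q] is
    the smaller of the two volumes they cover, and [E] counts open boundary edges. *)
Lemma points_isoperimetry U : 0 <= c0 -> total_weight U <= total_weight (~: U) ->
  kappa * total_weight U <= 2 * mu * edge_cut U \/
  exists q E : nat, [/\ (s.+1 ^ d)%:R * total_weight U <= 2 * mu * q%:R,
    (q ^ d.-1 <= (2 ^ (d + 5) * E) ^ d)%N & c0 * E%:R <= edge_cut U].
Proof.
move=> c00 UUc.
have split V : total_weight V = total_weight (deep V) + total_weight (V :\: deep V).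
  rewrite /total_weight [LHS](bigID (mem (deep V))) /=; congr (_ + _); apply: eq_bigl => u.
    by rewrite !inE; case: (u \in V).
  by rewrite !inE andbC.
have alt V : total_weight U <= total_weight V -> edge_cut V = edge_cut U ->
    kappa * total_weight U <= 2 * mu * edge_cut U \/ total_weight U <= 2 * total_weight (deep V).
  move=> UV cV; have [h|/ltW h] := leP (total_weight U) (2 * total_weight (deep V)); [by right|left].
  have := weight_not_deep V; rewrite cV => h2.
  have := ler_wpM2l kappa_ge0 h; have := ler_wpM2l kappa_ge0 UV.
  rewrite [total_weight V]split; move: h2; move: (total_weight _) (total_weight _) (total_weight _) (edge_cut _) => a e f g; nra.
have [|h1] := alt U (lexx _) erefl; first by left.
have [|h2] := alt (~: U) UUc (edge_cutC U); first by left.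
right; pose A := cells_of U.
pose F := [set kball s (jc u) | u in deep U] :|: [set kball s (jc u) | u in deep (~: U)].
exists (minn #|cover [set Q in F | Q \subset A]| #|cover [set Q in F | Q \subset ~: A]|),
  #|open_bdry Z A|.
have sd : 0 <= ((s.+1 ^ d)%:R : R) by [].
have covU V (B : {set cell}) : (forall u, u \in deep V -> kball s (jc u) \in F /\ kball s (jc u) \subset B) ->
    total_weight U <= 2 * total_weight (deep V) ->
    (s.+1 ^ d)%:R * total_weight U <= 2 * mu * #|cover [set Q in F | Q \subset B]|%:R.
  move=> VF UV; apply: le_trans (ler_wpM2l sd UV) _.
  rewrite mulrCA -[leRHS]mulrA ler_wpM2l //; apply: le_trans (double_counting _) _.
  rewrite ler_wpM2l // ler_nat subset_leq_card //; apply/bigcupsP => u /VF[uF uB].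
  by apply: (@bigcup_sup _ _ (kball s (jc u)) _ (fun Q => Q)); rewrite inE uF uB.
split; last exact: card_open_bdry.
  rewrite /minn; case: ifP => _; [apply: (covU U A)|apply: (covU (~: U) (~: A))] => //.
    move=> u ud; split; first by rewrite in_setU (imset_f (fun u => kball s (jc u)) ud).
    by move: ud; rewrite inE => /andP[].
  move=> u ud; split; first by rewrite in_setU orbC (imset_f (fun u => kball s (jc u)) ud).
  by move: ud; rewrite inE cells_ofC => /andP[].
apply: (percolation_isoperimetry d1 sparse (h := s.+1 ^ d)); last first.
  by rewrite ltn_exp2r //; lia.
move=> Q QF; suff [u QE mono] : exists2 u, Q = kball s (jc u) &
    kball s (jc u) \subset A \/ kball s (jc u) \subset ~: A.
  split; first by rewrite QE; exact: kconnected_kball.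
    by rewrite QE leq_card_kball.
  move=> x y xQ yQ; rewrite QE in xQ yQ; case: mono => /subsetP h.
    by rewrite !h.
  by have := h x xQ; have := h y yQ; rewrite !inE => /negPf-> /negPf->.
move: QF; rewrite inE => /orP[] /imsetP[u]; rewrite inE => /andP[_ uA] ->; exists u => //.
  by left.
by right; rewrite -cells_ofC.
Qed.

End Points.

From mathcomp Require Import all_classical all_reals all_analysis.
Import numFieldNormedType.Exports.
Local Open Scope classical_set_scope.
Local Open Scope ring_scope.

(** * The Peierls estimate *)

Section Occupation.
Variables (R : realType) (d : nat) (P : probability (Omega R d) R) (K : R).
Variables (n M : nat).
Local Notation cell := (cell d n).

(* The grid [{0..n}^d] is centred at the origin by the shift [M]. *)
Definition cell_pos (x : cell) : Zd d := \row_i ((x i)%:Z - M%:Z).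

Lemma cell_pos_inj : injective cell_pos.
Proof.
move=> x y /matrixP xy; apply/ffunP => i; apply/val_inj => /=.
by have := xy ord0 i; rewrite !mxE => /addIr[].
Qed.

Definition empties (xi : config R d) : {set cell} :=
  finset (fun x => ~~ occ K (cell_pos x) xi).

Lemma borel_cube (z : Zd d) : @borel_pt R d (cube K z).
Proof.
pose T := g_sigma_algebraType [set A : set (pt R d) | open A].
have oT (A : set (pt R d)) : open A -> measurable (A : set T).
  by move=> oA; exact: sub_sigma_algebra.
have -> : cube K z = \bigcap_(i in [set: 'I_d])
   ((~` ((fun y : pt R d => y ord0 i) @^-1` [set t | t < (z ord0 i)%:~R * K])) `&`
   ((fun y : pt R d => y ord0 i) @^-1` [set t | t < (z ord0 i)%:~R * K + K])).
  apply/seteqP; split => y /=.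
    by move=> h i _; have /andP[h1 h2] := h i; split => //=; apply/negP; rewrite -leNgt.
  by move=> h i; have [/= /negP + ->] := h i I; rewrite -leNgt => ->.
apply: (@fin_bigcap_measurable _ T) => // i _; apply: measurableI.
  apply: measurableC; apply: oT; apply: open_comp; last exact: open_lt.
  by move=> y _; exact: coord_continuous.
apply: oT; apply: open_comp; last exact: open_lt.
by move=> y _; exact: coord_continuous.
Qed.

Lemma bounded_cube (z : Zd d) : bounded_pt (cube K z).
Proof.
exists (\sum_i (`|(z ord0 i)%:~R * K| + `|K|)) => y yz i.
apply: le_trans (_ : `|(z ord0 i)%:~R * K| + `|K| <= _); last first.
  by rewrite (bigD1 i) //= lerDl sumr_ge0 // => j _; rewrite addr_ge0.
have /andP[h1 h2] := yz i; rewrite ler_norml.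
by have := ler_norm ((z ord0 i)%:~R * K); have := ler_norm K;
   have := ler_norm (- ((z ord0 i)%:~R * K)); have := normr_ge0 K; rewrite normrN; lra.
Qed.

Lemma measurable_occ (z : Zd d) : measurable [set xi : Omega R d | occ K z xi].
Proof.
have -> : [set xi : Omega R d | occ K z xi] =
    ~` [set xi : Omega R d | ((cpts xi `&` cube K z) #= `I_0)%card].
  apply/seteqP; split => xi /=; rewrite II0 card_eq0 /occ.
    by move=> /asboolP/set0P/negP.
  by move=> h; apply/asboolP/set0P/negP.
apply: measurableC; apply: sub_sigma_algebra; exists (cube K z), 0%N.
by split => //; [exact: borel_cube|exact: bounded_cube].
Qed.

(** An arbitrary [Q] is allowed because [empties] takes finitely many values. *)
Lemma measurable_empties (Q : {set cell} -> Prop) :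
  measurable [set xi : Omega R d | Q (empties xi)].
Proof.
have -> : [set xi : Omega R d | Q (empties xi)] =
   \bigcup_(W in [set W | Q W]) \bigcap_(x in [set: cell])
     (if x \in W then ~` [set xi : Omega R d | occ K (cell_pos x) xi]
      else [set xi : Omega R d | occ K (cell_pos x) xi]).
  apply/seteqP; split => xi /=.
    move=> Qxi; exists (empties xi) => // x _ /=; rewrite finset.inE.
    by case: ifPn => /=; [move/negP|rewrite negbK].
  move=> [W QW h]; suff -> : empties xi = W by [].
  apply/setP => x; rewrite finset.inE; have := h x I.
  by case: ifPn => xW /=; [move/negP|move=> ->].
apply: fin_bigcup_measurable => [|W _]; first exact: finite_finset.
apply: fin_bigcap_measurable => [|x _]; first exact: finite_finset.
by case: ifP => _; [apply: measurableC|]; exact: measurable_occ.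
Qed.

Lemma bern_weight_sum (p : R) (m : nat) :
  \sum_(om : {ffun 'I_m -> bool}) bern_weight p om = 1.
Proof.
rewrite -(bigA_distr_bigA (fun (k : 'I_m) (b : bool) => if b then p else 1 - p)).
by rewrite big1 // => k _; rewrite big_bool /= addrC subrK.
Qed.

(** Having fewer than [k] empty cells is an increasing event, to which domination applies. For the
    Bernoulli field, each of the at most [2 ^ #|V|] configurations in the complement has weight at
    most [(1 - p) ^+ k]. *)
Lemma prob_many_empties (p : R) (V : {set cell}) (k : nat) :
  0 < p < 1 -> dominates_bernoulli P K p ->
  (P [set xi : Omega R d | (k <= #|V :&: empties xi|)%N] <=
    (2 ^+ #|V| * (1 - p) ^+ k)%:E)%E.
Proof.
move=> /andP[p0 p1] dom.
pose f (j : 'I_#|V|) := cell_pos (enum_val j).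
have f_inj : injective f by move=> i j /cell_pos_inj/enum_val_inj.
pose A := [set om : {ffun 'I_#|V| -> bool} | (#|[pred j | ~~ om j]| < k)%N].
have A_incr : increasing_ev A.
  move=> om om' /= omA oo; apply: leq_ltn_trans omA; apply/subset_leq_card/fintype.subsetP => j.
  by rewrite !inE; apply: contra; exact/implyP.
have mE : measurable [set xi : Omega R d | (k <= #|V :&: empties xi|)%N].
  exact: (measurable_empties (fun W => (k <= #|V :&: W|)%N)).
have cardE xi : #|[pred j | ~~ [ffun j => occ K (f j) xi] j]| = #|V :&: empties xi|.
  rewrite -(card_imset _ (@enum_val_inj _ (mem V))); apply: eq_card => x.
  rewrite finset.inE; apply/imsetP/andP => [[j + ->]|[xV]].
    by rewrite enum_valP finset.inE inE ffunE.
  rewrite finset.inE => xe; exists (enum_rank_in xV x); last by rewrite enum_rankK_in.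
  by rewrite !inE ffunE /f enum_rankK_in.
have -> : [set xi : Omega R d | (k <= #|V :&: empties xi|)%N] =
  ~` [set xi : Omega R d | A [ffun j => occ K (f j) xi]].
  by apply/seteqP; split => xi; rewrite /A /= cardE => h; [apply/negP|move/negP: h]; rewrite -leqNgt.
have mA : measurable [set xi : Omega R d | A [ffun j => occ K (f j) xi]].
  rewrite -[X in measurable X]setCK; apply: measurableC.
  apply: eq_ind mE _ _; apply/seteqP; split => xi; rewrite /A /= cardE => h;
   [apply/negP|move/negP: h]; by rewrite -leqNgt.
rewrite probability_setC //; apply: le_trans (leeB (lexx _) (dom _ f f_inj A A_incr)) _.
rewrite -EFinB lee_fin -[X in X - _ <= _](bern_weight_sum p #|V|) (bigID (fun om => `[< A om >])) /=.
rewrite [X in X - _]addrC addrK.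
apply: (@le_trans _ _ (\sum_(om : {ffun 'I_#|V| -> bool}) (1 - p) ^+ k)); last first.
  by rewrite sumr_const card_ffun card_bool card_ord -[_ *+ (_ ^ _)]mulr_natl natrX.
rewrite [leLHS]big_mkcond /=; apply: ler_sum => om _.
have q0 : 0 <= 1 - p by rewrite subr_ge0 ltW.
case: ifPn => [/asboolPn /negP|_]; last exact: exprn_ge0.
rewrite -leqNgt => kom; rewrite /bern_weight (bigID om) /= -[leRHS]mul1r ler_pM //.
- by rewrite prodr_ge0 // => j ->; exact: ltW.
- by rewrite prodr_ge0 // => j /negPf->.
- by rewrite prodr_ile1 // => j ->; rewrite !ltW.
rewrite (eq_bigr (fun=> 1 - p)) => [|j /negPf->//]; rewrite prodr_const.
by rewrite ler_wiXn2l // lerBlDr lerDl ltW.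
Qed.

End Occupation.

(** As [r <= 1/2], each [r ^+ k] is at most [2 * (r ^+ k - r ^+ k.+1)], which telescopes. *)
Lemma sum_geometric_tail (R : realType) (r : R) (m N : nat) : 0 <= r -> r <= 2^-1 ->
  \sum_(k < N | (m <= k)%N) r ^+ k <= 2 * r ^+ m.
Proof.
move=> r0 r2; rewrite -(big_geq_mkord _ _ predT (fun k => r ^+ k)).
have [mN|Nm] := leqP m N; last first.
  by rewrite big_geq ?mulr_ge0 ?exprn_ge0 // ltnW.
apply: (@le_trans _ _ (\sum_(m <= k < N) (- 2 * r ^+ k.+1 - (- 2 * r ^+ k)))).
  apply: ler_sum => k _; rewrite exprS.
  by have := exprn_ge0 k r0; move: (r ^+ k) => s s0; nra.
by rewrite telescope_sumr //; have := exprn_ge0 N r0; lra.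
Qed.

Lemma measure_bigsetU_le d (T : measurableType d) (R : realType)
    (mu : {measure set T -> \bar R}) (I : finType) (Q : pred I) (F : I -> set T) :
  (forall i, measurable (F i)) ->
  (mu (\big[setU/set0]_(i | Q i) F i) <= \sum_(i | Q i) mu (F i))%E.
Proof.
move=> mF; elim: (index_enum I) => [|i r IH]; first by rewrite !big_nil measure0.
rewrite !big_cons; case: ifP => // _; apply: le_trans (leeD (lexx _) IH).
by apply: measureU2 => //; exact: bigsetU_measurable.
Qed.

(** * Union bound over connected sets with too many empty cells *)

Section Sparse.
Variables (R : realType) (d : nat) (P : probability (Omega R d) R) (K : R).

Let H : nat := (8 * 3 ^ d)%N.
(** Per cell, a factor [9 ^ d] pays for the choice of the connected set and a factor 2 for that of
    its empty cells; [c] brings the product down to [2 ^ -(d + 2)]. *)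
Let c : R := ((2 ^ (d + 3) * 9 ^ d)%N%:R)^-1.

Definition sparse_bad (n M m0 : nat) : set (Omega R d) :=
  [set xi | exists V : {set cell d n}, [/\ kconnected V, (m0 <= #|V|)%N &
     (#|V| < 8 * 3 ^ d * #|V :&: empties K n M xi|)%N]].

Lemma measurable_sparse_bad n M m0 : measurable (sparse_bad n M m0).
Proof.
exact: (measurable_empties K M (fun W => exists V : {set cell d n},
  [/\ kconnected V, (m0 <= #|V|)%N & (#|V| < 8 * 3 ^ d * #|V :&: W|)%N])).
Qed.

Let c_gt0 : 0 < c.
Proof. by rewrite /c invr_gt0 ltr0n muln_gt0 !expn_gt0. Qed.

Let c_le : c <= 2^-1.
Proof.
rewrite /c lef_pV2 ?posrE ?ltr0n ?muln_gt0 ?expn_gt0 // ler_nat.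
by rewrite addn3 2!expnS -mulnA leq_pmulr // !muln_gt0 !expn_gt0.
Qed.

(** A bad set of [k] cells has more than [k / H] empty ones. As [1 - p = c ^+ H], this has
    probability at most [(2 * c) ^+ k], and [card_animals] reduces the sum to a geometric tail. *)
Lemma prob_sparse_bad n M m0 : dominates_bernoulli P K (1 - c ^+ H) -> (0 < m0)%N ->
  (P (sparse_bad n M m0) <=
    (2 * (n.+1 ^ d)%:R * ((2 ^ (d + 2))%:R^-1) ^+ m0)%:E)%E.
Proof.
move=> dom m00.
have H0 : (0 < H)%N by rewrite muln_gt0 expn_gt0.
have c1 : c < 1 by apply: le_lt_trans c_le _; rewrite invf_lt1 ?ltr1n.
have p01 : 0 < 1 - c ^+ H < 1.
  rewrite subr_gt0 ltrBlDr ltrDl exprn_gt0 // andbT.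
  by rewrite exprn_ilt1 ?(ltW c_gt0) -?lt0n.
pose good (V : {set cell d n}) := `[< kconnected V >] && (m0 <= #|V|)%N.
pose E (V : {set cell d n}) :=
  [set xi : Omega R d | ((#|V| %/ H).+1 <= #|V :&: empties K n M xi|)%N].
have mE V : measurable (E V).
  exact: (measurable_empties K M (fun W => ((#|V| %/ H).+1 <= #|V :&: W|)%N)).
apply: (@le_trans _ _ (P (\big[setU/set0]_(V | good V) E V))).
  apply: le_measure; rewrite ?inE.
  - exact: measurable_sparse_bad.
  - exact: bigsetU_measurable.
  move=> xi [V [Vc Vm Vs]]; rewrite (bigD1 V) /=; last by rewrite /good Vm andbT; exact/asboolP.
  by left; rewrite /E /= ltn_divLR // mulnC.
apply: le_trans (measure_bigsetU_le _ _ mE) _.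
apply: (@le_trans _ _ (\sum_(V | good V) ((2 * c) ^+ #|V|)%:E)%E).
  apply: lee_sum => V _; apply: le_trans (prob_many_empties M V _ p01 dom) _.
  rewrite lee_fin subKr exprMn ler_wpM2l ?exprn_ge0 // -exprM.
  apply: ler_wiXn2l; rewrite ?(ltW c_gt0) ?(ltW c1) //.
  by rewrite mulnC ltnW // -ltn_divLR.
rewrite sumEFin lee_fin.
rewrite (partition_big (fun V : {set cell d n} => inord #|V| : 'I_(#|cell d n|.+1))
  (fun k => (m0 <= k)%N)) /=; last first.
  by move=> V /andP[_ Vm]; rewrite inordK // ltnS max_card.
have r0 : 0 <= ((2 ^ (d + 2))%:R^-1 : R) by rewrite invr_ge0.
apply: (@le_trans _ _ (\sum_(k < #|cell d n|.+1 | (m0 <= k)%N)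
    (n.+1 ^ d)%:R * (2 ^ (d + 2))%:R^-1 ^+ k)); last first.
  rewrite -mulr_sumr mulrAC [leRHS]mulrC; apply: ler_wpM2l => //.
  apply: sum_geometric_tail => //; rewrite lef_pV2 ?posrE ?ltr0n ?expn_gt0 // ler_nat.
  by rewrite addn2 expnS leq_pmulr // expn_gt0.
apply: ler_sum => -[[|k] kn] /= mk; first by rewrite leqNgt m00 in mk.
pose F : {set {set cell d n}} := finset (fun V => good V && (inord #|V| == Ordinal kn)).
have FP V : V \in F -> kconnected V /\ #|V| = k.+1.
  rewrite finset.inE => /andP[/andP[/asboolP Vc _] /eqP/(congr1 val)].
  by rewrite /= inordK // ltnS max_card.
rewrite (eq_bigl (mem F)) => [|V]; last by rewrite !finset.inE.
rewrite (eq_bigr (fun=> (2 * c) ^+ k.+1)) => [|V /FP[_ ->] //].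
rewrite sumr_const -[_ *+ #|_|]mulr_natl.
apply: (@le_trans _ _ ((n.+1 ^ d * 9 ^ (d * k.+1))%:R * (2 * c) ^+ k.+1)).
  apply: ler_wpM2r; first by rewrite exprn_ge0 ?mulr_ge0 ?(ltW c_gt0).
  rewrite ler_nat (leq_trans (card_animals FP)) //.
  rewrite leq_mul2l; apply/orP; right; rewrite (_ : 9 = 3 ^ 2)%N // -!expnM.
  by rewrite leq_exp2l //; lia.
rewrite natrM -mulrA; apply: ler_wpM2l => //; rewrite expnM natrX -exprMn /c.
apply: lerXn2r; rewrite ?nnegrE ?mulr_ge0 // ?invr_ge0 //.
rewrite addnS expnS !natrM.
have : 0 < ((9 ^ d)%:R : R) by rewrite ltr0n expn_gt0.
have : 0 < ((2 ^ (d + 2))%:R : R) by rewrite ltr0n expn_gt0.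
move: (9 ^ d)%:R (2 ^ (d + 2))%:R => u v v0 u0.
by rewrite le_eqVlt; apply/orP; left; apply/eqP; field; rewrite !gt_eqF.
Qed.

End Sparse.

(** The upper bounds telescope, so the probabilities have sum at most the absolute value of [C]. *)
Lemma borel_cantelli_telescope d (T : measurableType d) (R : realType)
    (P : probability T R) (F : nat -> set T) (C : R) :
  (forall k, measurable (F k)) ->
  (forall k, (P (F k) <= (C * (k.+1%:R^-1 - k.+2%:R^-1))%:E)%E) ->
  P (lim_sup_set F) = 0%E.
Proof.
move=> mF FC; apply: lim_sup_set_cvg0 => //; apply: (@le_lt_trans _ _ `|C|%:E); last exact: ltry.
apply: lime_le; first exact: is_cvg_nneseries.
apply: nearW => N; apply: (@le_trans _ _ (\sum_(0 <= k < N) (C * (k.+1%:R^-1 - k.+2%:R^-1))%:E)%E).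
  by apply: lee_sum => k _; exact: FC.
rewrite sumEFin lee_fin -mulr_sumr.
have -> : \sum_(0 <= k < N) (k.+1%:R^-1 - k.+2%:R^-1 : R) = 1 - N.+1%:R^-1.
  rewrite (eq_bigr (fun k => - k.+2%:R^-1 - (- k.+1%:R^-1 : R))); last by move=> k _; rewrite opprK addrC.
  by rewrite telescope_sumr // invr1 opprK addrC.
have N1 : (N.+1%:R^-1 : R) <= 1 by rewrite invf_le1 ?ltr0n // ler1n.
have N0 : 0 <= (N.+1%:R^-1 : R) by rewrite invr_ge0.
apply: le_trans (ler_norm _) _; rewrite normrM ler_piMr // ger0_norm ?subr_ge0 //.
Qed.

(** The number of cells that fit between the origin and a face of the window; a margin narrower than
    [K] stays uncovered at each face. *)
Definition half_side (R : realType) (K : R) (L : nat) : nat := Num.truncn (L%:R / (2 * K)).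

Section HalfSide.
Variables (R : realType) (K : R).
Hypothesis K0 : 0 < K.

Lemma half_side_bounds L : K * (half_side K L)%:R <= L%:R / 2 < K * (half_side K L)%:R + K.
Proof.
have h0 : 0 <= L%:R / (2 * K) by rewrite divr_ge0 // mulr_ge0 // ltW.
have := truncn_itv h0; rewrite -/(half_side K L) -[(half_side K L).+1%:R]natr1 => /andP[].
rewrite ler_pdivlMr ?mulr_gt0 // ltr_pdivrMr ?mulr_gt0 //.
move: ((half_side K L)%:R : R) => m; move: (L%:R : R) => l h1 h2; apply/andP; split; lra.
Qed.

Lemma half_side_ge (c : nat) : exists L0, forall L, (L0 <= L)%N -> (c <= half_side K L)%N.
Proof.
exists (Num.truncn (2 * K * c%:R)).+1 => L LL.
have /andP[_ h] := half_side_bounds L.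
have h2 : 2 * K * c%:R < L%:R.
  by apply: lt_le_trans (truncnS_gt _) _; rewrite ler_nat.
rewrite leqNgt; apply/negP; rewrite -(ler_nat R) -addn1 natrD => h3.
have := ler_wpM2l (ltW K0) h3.
by move: h h2; move: ((half_side K L)%:R : R) (c%:R : R) (L%:R : R) => m c' l; lra.
Qed.

End HalfSide.

Lemma eventually_sparse (R : realType) (d : nat) (P : probability (Omega R d) R) :
  A1 P -> exists K : R, 0 < K /\ as_eventually P (fun L xi =>
    ~ sparse_bad K (half_side K L).*2.-1 (half_side K L) (trunc_log 2 L).+1 xi).
Proof.
move=> hA1.
pose c : R := ((2 ^ (d + 3) * 9 ^ d)%N%:R)^-1.
have c0 : 0 < c by rewrite invr_gt0 ltr0n muln_gt0 !expn_gt0.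
have c1 : c < 1.
  rewrite invf_lt1 ?ltr0n ?ltr1n ?muln_gt0 ?expn_gt0 // addn3 expnS -mulnA.
  by apply: (@leq_mul 2 1); rewrite // muln_gt0 !expn_gt0.
have /hA1[K [K0 dom]] : 0 < 1 - c ^+ (8 * 3 ^ d) < 1.
  rewrite subr_gt0 ltrBlDr ltrDl exprn_gt0 // andbT.
  by rewrite exprn_ilt1 ?(ltW c0) // -?lt0n ?muln_gt0 expn_gt0.
exists K; split => //.
pose M L := half_side K L.
(* When [M L = 0] the predecessor truncates and the grid would not have [(M L).*2] cells per axis;
   the event is made empty for these [L], which are finitely many. *)
pose bad L : set (Omega R d) := if (0 < M L)%N then
  sparse_bad K (M L).*2.-1 (M L) (trunc_log 2 L).+1 else set0.
have mbad L : measurable (bad L).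
  by rewrite /bad; case: ifP => // _; exact: measurable_sparse_bad.
have Pbad L : (P (bad L) <= (12 * K^-1 ^+ d * (L.+1%:R^-1 - L.+2%:R^-1))%:E)%E.
  rewrite /bad; case: ifPn => [M0|_]; last first.
    rewrite measure0 lee_fin mulr_ge0 ?mulr_ge0 ?exprn_ge0 ?invr_ge0 ?(ltW K0) //.
    by rewrite subr_ge0 lef_pV2 ?posrE ?ltr0n // ler_nat.
  apply: le_trans (prob_sparse_bad _ _ dom _) _ => //.
  rewrite lee_fin prednK ?double_gt0 //.
  have /andP[ML _] := half_side_bounds K0 L.
  have L0 : (0 < L)%N.
    by rewrite lt0n; apply/eqP => L0; move: M0; rewrite /M L0 /half_side mul0r truncn0.
  have L0' : 0 < (L%:R : R) by rewrite ltr0n.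
  have NL : ((M L).*2 ^ d)%:R <= (L%:R * K^-1) ^+ d :> R.
    rewrite natrX lerXn2r ?nnegrE ?mulr_ge0 ?invr_ge0 ?(ltW K0) //.
    by rewrite ler_pdivlMr // -muln2 natrM; move: ML; rewrite /M; lra.
  (* As [2 ^ (trunc_log 2 L).+1] exceeds [L], the tail beats the number of cells, of order [L ^ d],
     by a summable factor [L ^ -2]. *)
  have mL : ((2 ^ (d + 2))%:R^-1 : R) ^+ (trunc_log 2 L).+1 <= (L%:R ^+ (d + 2))^-1.
    rewrite exprVn lef_pV2 ?posrE ?exprn_gt0 ?ltr0n ?expn_gt0 //.
    by rewrite -!natrX ler_nat -expnM mulnC expnM leq_exp2r ?addn2 // ltnW // trunc_log_ltn.
  apply: (@le_trans _ _ (2 * (L%:R * K^-1) ^+ d * (L%:R ^+ (d + 2))^-1)).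
    by apply: ler_pM => //; rewrite ?mulr_ge0 ?exprn_ge0 ?invr_ge0 // ler_wpM2l.
  have -> : 2 * (L%:R * K^-1) ^+ d * (L%:R ^+ (d + 2))^-1 = 2 * K^-1 ^+ d * (L%:R ^+ 2)^-1 :> R.
    by rewrite exprMn exprD; field; rewrite !expf_neq0 ?gt_eqF.
  (* The 6 comes from [(L + 1) * (L + 2) <= 6 * L ^ 2] for [L >= 1]. *)
  rewrite -!mulrA (_ : 12 = 2 * 6 :> R); last by ring.
  rewrite -!mulrA ler_wpM2l // [6 * _]mulrCA ler_wpM2l ?exprn_ge0 ?invr_ge0 ?(ltW K0) //.
  have L1 : 1 <= (L%:R : R) by rewrite ler1n.
  rewrite -[L.+2%:R]natr1 -[L.+1%:R]natr1; move: (L%:R : R) L1 L0' => l l1 l0.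
  have -> : (l + 1)^-1 - (l + 1 + 1)^-1 = ((l + 1) * (l + 1 + 1))^-1.
    by field; rewrite !gt_eqF; lra.
  by rewrite -[leLHS]mul1r ler_pdivrMr ?exprn_gt0 // mulrAC ler_pdivlMr ?mulr_gt0 //; [nra|lra|lra].
have PO := borel_cantelli_telescope mbad Pbad.
have [L0 ML0] := half_side_ge K0 1.
exists (~` lim_sup_set bad); split.
- apply: measurableC; apply: bigcap_measurable => // k _.
  by apply: bigcup_measurable.
- rewrite probability_setC ?PO ?sube0 //.
  by apply: bigcap_measurable => // k _; apply: bigcup_measurable.
move=> xi; rewrite /lim_sup_set setC_bigcap => -[k _ nbad].
exists (maxn k L0) => L; rewrite geq_max => /andP[kL L0L] bL; apply: nbad.
by exists L => //; rewrite /bad ML0.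
Qed.

From mathcomp Require Import finmap.

(** * Geometry of the configuration *)

(** Carries sums over sets of points to the finite type of points of [S], where the combinatorial
    results apply. *)
Lemma fsum_fset_set (R : realDomainType) (I : choiceType) (S U : set I) (f : I -> R) :
  finite_set S -> U `<=` S ->
  \sum_(x \in U) f x = \sum_(t : fset_set S | val t \in U) f (val t).
Proof.
move=> Sfin US; rewrite -(@big_seq_fsetE _ _ _ _ (fset_set S) (fun x : I => x \in U) f).
rewrite -big_filter [RHS]fsbig_seq ?filter_uniq //; apply: eq_fsbigl.
apply/seteqP; split => x /=; rewrite mem_filter in_fset_set //.
  by move=> xU; rewrite !mem_set //; exact: US.
by case/andP => /set_mem.
Qed.

Section Kernel.
Variables (R : realType) (d : nat) (alpha : R).
Hypothesis a0 : 0 < alpha.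
Implicit Types x y : pt R d.

Lemma edistC x y : Defs.edist x y = Defs.edist y x.
Proof. by rewrite /Defs.edist; congr Num.sqrt; apply: eq_bigr => i _; rewrite -opprB sqrrN. Qed.

Lemma kernC x y : kern alpha x y = kern alpha y x.
Proof. by rewrite /kern edistC. Qed.

Lemma kern_gt0 x y : 0 < kern alpha x y.
Proof. exact: expR_gt0. Qed.

Lemma kern_refl x : kern alpha x x = 1.
Proof.
rewrite /kern /Defs.edist big1 ?sqrtr0 ?powR0 ?gt_eqF // ?oppr0 ?expR0 // => i _.
by rewrite subrr expr0n.
Qed.

Lemma edist_le x y (r : R) : (0 < d)%N -> (forall i, `|x ord0 i - y ord0 i| <= r) ->
  Defs.edist x y <= d%:R * r.
Proof.
move=> d0 h; have r0 : 0 <= r by apply: le_trans (h (Ordinal d0)).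
rewrite /Defs.edist -[leRHS]ger0_norm ?mulr_ge0 // -sqrtr_sqr ler_sqrt ?sqr_ge0 //.
apply: (@le_trans _ _ (\sum_(i < d) r ^+ 2)).
  by apply: ler_sum => i _; rewrite -real_normK ?num_real // lerXn2r ?nnegrE.
rewrite sumr_const card_ord -[_ *+ d]mulr_natl exprMn; apply: ler_wpM2r; first exact: sqr_ge0.
by rewrite -natrX ler_nat -[X in (X <= _)%N]expn1 leq_pexp2l.
Qed.

Lemma kern_ge x y (r : R) : (0 < d)%N -> (forall i, `|x ord0 i - y ord0 i| <= r) ->
  expR (- ((d%:R * r) `^ alpha)) <= kern alpha x y.
Proof.
move=> d0 h; have r0 : 0 <= r by apply: le_trans (h (Ordinal d0)).
rewrite /kern ler_expR lerN2; apply: ge0_ler_powR; rewrite ?nnegrE ?mulr_ge0 //.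
- exact: ltW.
- exact: sqrtr_ge0.
- exact: edist_le.
Qed.

Lemma Lam_bounded (L : nat) : bounded_pt (@Lam R d L).
Proof. by exists (L%:R / 2) => x xL i; rewrite ler_norml. Qed.

Lemma xiL_finite (xi : config R d) L : finite_set (xiL xi L).
Proof. exact: cpts_locfin (Lam_bounded L). Qed.

Lemma RA_ge (xi : config R d) L (V : set (pt R d)) :
  ((\sum_(t : fset_set (xiL xi L) | val t \in V)
    \sum_(u : fset_set (xiL xi L)) kern alpha (val t) (val u))%:E <= RA alpha V xi)%E.
Proof.
have Sfin := xiL_finite xi L.
apply: esum_ge; exists (xiL xi L `&` V).
  split; first exact: sub_finite_set Sfin.
  by move=> x [[]].
apply: (@le_trans _ _ (\sum_(x \in xiL xi L `&` V) (\sum_(y \in xiL xi L) kern alpha x y)%:E)%E).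
  rewrite fsumEFin; last exact: sub_finite_set Sfin.
  rewrite lee_fin (@fsum_fset_set _ _ (xiL xi L)) //.
  rewrite le_eqVlt; apply/orP; left; apply/eqP.
  have inS (t : fset_set (xiL xi L)) : val t \in xiL xi L.
    by have := valP t; rewrite in_fset_set.
  apply: eq_big => [t|t _].
    by rewrite in_setI inS.
  rewrite (@fsum_fset_set _ _ (xiL xi L)) //.
  by apply: eq_bigl => u; rewrite inS.
apply: lee_fsum; first exact: sub_finite_set Sfin.
move=> x _; apply: esum_ge; exists (xiL xi L).
  by split => // y [].
by rewrite fsumEFin.
Qed.

End Kernel.

Section Weights.
Variables (R : realType) (d : nat) (alpha : R) (xi : config R d) (L i : nat).
Hypothesis a0 : 0 < alpha.
Local Notation S := (xiL xi L).
Local Notation T := (fset_set (xiL xi L)).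

Definition wT (t : T) : R := wt i alpha S (val t).
Definition kT (t u : T) : R := kern alpha (val t) (val u).
Definition setT_of (U : set (pt R d)) : {set T} := finset (fun t : T => val t \in U).

Lemma val_in_xiL (t : T) : S (val t).
Proof. by have := valP t; rewrite in_fset_set; [move/set_mem|exact: xiL_finite]. Qed.

Lemma w2E (t : T) : w2 alpha S (val t) = \sum_(u | u != t) kT t u.
Proof.
rewrite /w2 (@fsum_fset_set _ _ S) ?subDsetl //; last exact: xiL_finite.
apply: eq_bigl => u; have uS := val_in_xiL u.
apply/idP/idP => [/set_mem[_ /= ut]|ut].
  by apply/eqP => e; apply: ut; rewrite e.
by apply/mem_set; split => //= e; case/eqP: ut; apply: val_inj.
Qed.

(** The sum contains the diagonal term 1, so it equals [1 + w2], which dominates the weights of all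
    three models. With [RA_ge], Assumption (A2) thus controls each of them. *)
Lemma wT_le (t : T) : wT t <= \sum_u kT t u.
Proof.
have k0 u : 0 <= kT t u by exact/ltW/kern_gt0.
rewrite (bigD1 t) //= /kT kern_refl // -/(kT t _).
have s0 : 0 <= \sum_(u | u != t) kT t u by exact: sumr_ge0.
rewrite /wT /wt -w2E in s0 *.
by case: i => [|[|[|j]]]; rewrite ?ge_max ?lerDl ?lerDr // s0 ler01.
Qed.

Lemma wT_ge0 t : 0 <= wT t.
Proof.
have s0 : 0 <= w2 alpha S (val t) by rewrite w2E sumr_ge0 // => u _; exact/ltW/kern_gt0.
by rewrite /wT /wt; case: i => [|[|[|j]]]; rewrite ?le_max ?ler01.
Qed.

(** In the second model a point alone in the window has weight 0, hence the second point [u]. *)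
Lemma wT_gt0 t u : u != t -> 0 < wT t.
Proof.
move=> ut; have s0 : 0 < w2 alpha S (val t).
  rewrite w2E (bigD1 u) //= ltr_pwDl ?kern_gt0 // sumr_ge0 // => v _.
  exact/ltW/kern_gt0.
by rewrite /wT /wt; case: i => [|[|[|j]]]; rewrite ?lt_max ?ltr01.
Qed.

Lemma WtE U : U `<=` S -> Wt i alpha S U = total_weight wT (setT_of U).
Proof.
move=> US; rewrite /Wt (@fsum_fset_set _ _ S) //; last exact: xiL_finite.
by apply: eq_bigl => t; rewrite finset.inE.
Qed.

Lemma setT_of_xiL : setT_of S = [set: T]%SET.
Proof. by apply/setP => t; rewrite !finset.inE; apply/mem_set; exact: val_in_xiL. Qed.

Lemma IsoE U : U `<=` S ->
  Iso i alpha S U = (total_weight wT (setT_of U))^-1 * edge_cut kT (setT_of U).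
Proof.
move=> US; rewrite /Iso WtE //; congr (_ * _).
rewrite (@fsum_fset_set _ _ S) //; last exact: xiL_finite.
apply: eq_big => [t|t _]; first by rewrite finset.inE.
rewrite (@fsum_fset_set _ _ S) ?subDsetl //; last exact: xiL_finite.
apply: eq_bigl => u; rewrite !finset.inE; have uS := val_in_xiL u.
apply/idP/negP => [/set_mem[_ /= uU] /set_mem //|uU].
by apply/mem_set; split => // h; apply: uU; apply/mem_set.
Qed.

End Weights.

(** * Cells, boxes and representatives in the window *)

Section Geometry.
Variables (R : realType) (d : nat) (alpha K : R) (xi : config R d) (L i m0 b s : nat).
Local Notation M := (half_side K L).
Local Notation n := ((half_side K L).*2.-1).
Local Notation S := (xiL xi L).
Local Notation T := (fset_set (xiL xi L)).
Local Notation cell := (cell d n).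
Local Notation Z := (empties K n M xi).

Hypothesis d1 : (1 < d)%N.
Hypothesis a0 : 0 < alpha.
Hypothesis K0 : 0 < K.
Hypothesis M0 : (0 < M)%N.
Hypothesis sparse : ~ sparse_bad K n M m0 xi.
Hypothesis bd : (m0 <= b.+1 ^ d)%N.
Hypothesis bn : (b <= n)%N.

Let d0 : (0 < d)%N. Proof. exact: ltnW. Qed.

Lemma nE : n.+1 = M.*2.
Proof. by rewrite prednK // double_gt0. Qed.

Lemma not_sparse_bad (V : {set cell}) : kconnected V -> (m0 <= #|V|)%N ->
  (8 * 3 ^ d * #|V :&: Z| <= #|V|)%N.
Proof. by move=> Vc Vm; rewrite leqNgt; apply/negP => h; apply: sparse; exists V. Qed.

Lemma cell_cubeP (x : cell) (y : pt R d) : cube K (cell_pos M x) y <->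
  forall j, ((x j)%:R - M%:R) * K <= y ord0 j < ((x j)%:R - M%:R) * K + K.
Proof. by rewrite /cube /=; split => h j; have := h j; rewrite mxE intrB. Qed.

Lemma cell_cube_Lam (x : cell) : cube K (cell_pos M x) `<=` @Lam R d L.
Proof.
move=> y /cell_cubeP h j; have /andP[h1 h2] := h j.
have /andP[ML _] := half_side_bounds K0 L.
have xM : (x j)%:R + 1 <= M%:R + M%:R :> R.
  by rewrite -natrD natr1 ler_nat addnn (leq_trans (ltn_ord (x j))) // nE.
have x0 : 0 <= (x j)%:R :> R by [].
move: h1 h2 ML xM x0; move: ((x j)%:R : R) (M%:R : R) (L%:R : R) (y ord0 j) => u m l v.
by move=> h1 h2 ML xM x0; apply/andP; split; nra.
Qed.

(** The ball of radius [b] is connected and has at least [m0] cells, so sparsity prevents it from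
    being entirely empty. *)
Lemma occupied_nearby (x : cell) :
  exists x' : cell, [/\ knear b x x', x' \notin Z & x \notin Z -> x' = x].
Proof.
have [xZ|xZ] := boolP (x \in Z); last by exists x; split => //; exact: knear_refl.
have hb := leq_card_kball x bn.
have := not_sparse_bad (@kconnected_kball _ _ b x) (leq_trans bd hb).
have [/existsP[x' /andP[xx' x'Z]]|no] := boolP [exists x', (x' \in kball b x) && (x' \notin Z)].
  by exists x'; split => //; rewrite finset.inE in xx'.
have -> : kball b x :&: Z = kball b x.
  apply/finset.setIidPl/fintype.subsetP => y yb; apply: contraR no => yZ.
  by apply/existsP; exists y; rewrite yb.
have : (0 < #|kball b x|)%N by rewrite (leq_trans _ hb) // expn_gt0.
have : (0 < 3 ^ d)%N by rewrite expn_gt0.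
by move: (3 ^ d)%N #|_| => u v u0 v0; nia.
Qed.

Lemma rep_exists : exists rep : cell -> T, forall x, exists x' : cell,
  [/\ knear b x x', cube K (cell_pos M x') (val (rep x)) & x \notin Z -> x' = x].
Proof.
suff h : forall x : cell, exists t : T, exists x' : cell,
  [/\ knear b x x', cube K (cell_pos M x') (val t) & x \notin Z -> x' = x].
  by have [rep repP] := choice h; exists rep.
move=> x; have [x' [xx' x'Z x'x]] := occupied_nearby x.
move: x'Z; rewrite finset.inE negbK => /asboolP[y [yxi yx']].
have yS : y \in T.
  rewrite in_fset_set; last exact: xiL_finite.
  by apply/mem_set; split => //; exact: cell_cube_Lam yx'.
by exists (FSetSub yS), x'.
Qed.

(** Points in the uncovered margin are clamped to the grid: [minn] acts at the upper faces, and
    [truncn], which is 0 on negative numbers, at the lower ones. *)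
Definition nearest_cell (t : T) : cell :=
  [ffun j => inord (minn (Num.truncn ((val t ord0 j + M%:R * K) / K)) n)].

(** One [K] accounts for the cell and another for the margin, which is narrower than [K]. *)
Lemma nearest_cellP (t : T) j :
  `|val t ord0 j - ((nearest_cell t j)%:R - M%:R) * K| <= 2 * K.
Proof.
have [_ /(_ j) /andP[t1 t2]] := val_in_xiL t.
have /andP[_ ML] := half_side_bounds K0 L.
rewrite ffunE inordK; last by rewrite ltnS geq_minr.
move: (val t ord0 j) t1 t2 => v t1 t2.
have nR : n%:R + 1 = M%:R + M%:R :> R by rewrite natr1 nE -addnn natrD.
have [v0|v0] := leP 0 (v + M%:R * K); last first.
  have -> : Num.truncn ((v + M%:R * K) / K) = 0%N.
    apply/truncn0Pn; rewrite -ltNge; apply: lt_trans (ltr01).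
    by rewrite pmulr_llt0 ?invr_gt0.
  rewrite min0n; move: nR ML v0 t1 t2; move: (M%:R : R) (L%:R : R) => m l nR ML v0 t1 t2.
  by rewrite ler_norml; apply/andP; split; nra.
have q0 : 0 <= (v + M%:R * K) / K by rewrite divr_ge0 // ltW.
have := truncn_itv q0; rewrite -[(Num.truncn (_ / K)).+1%:R]natr1 ler_pdivlMr // ltr_pdivrMr //.
set q := Num.truncn ((v + _) / K) => /andP[q1 q2].
have [qn|/ltnW qn] := leqP q n.
  rewrite ler_norml.
  move: q1 q2; move: (M%:R : R) (q%:R : R) => m q' q1 q2.
  by apply/andP; split; nra.
rewrite ler_norml; rewrite -(ler_nat R) in qn.
move: nR ML v0 t1 t2 q1 q2 qn; move: (M%:R : R) (q%:R : R) (L%:R : R) (n%:R : R) => m q' l n'.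
by move=> nR ML v0 t1 t2 q1 q2 qn; apply/andP; split; nra.
Qed.

Lemma knear_coord (r : nat) (x y : cell) j : knear r x y ->
  `|((x j)%:R - (y j)%:R) * K| <= r%:R * K.
Proof.
move=> /knearP/(_ j)[h1 h2]; rewrite normrM (gtr0_norm K0) ler_pM2r // ler_norml.
rewrite -(ler_nat R) natrD in h1; rewrite -(ler_nat R) natrD in h2.
by apply/andP; split; lra.
Qed.

Lemma knear_of_coord (r : nat) (x y : cell) :
  (forall j, `|((x j)%:R - (y j)%:R) * K| <= r%:R * K) -> knear r x y.
Proof.
move=> h; apply/knearP => j; have := h j; rewrite normrM (gtr0_norm K0) ler_pM2r //.
rewrite ler_norml => /andP[h1 h2]; rewrite -!(ler_nat R) !natrD.
by split; lra.
Qed.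

Lemma val_gap (r : nat) (t u : T) j : knear r (nearest_cell t) (nearest_cell u) ->
  `|val t ord0 j - val u ord0 j| <= (r + 4)%:R * K.
Proof.
move=> /(knear_coord j); have := nearest_cellP t j; have := nearest_cellP u j.
rewrite natrD; move: (val t ord0 j) (val u ord0 j) => v1 v2.
move: ((nearest_cell t j)%:R : R) ((nearest_cell u j)%:R : R) (r%:R : R) (M%:R : R).
move=> c1 c2 r' m; rewrite !ler_norml => /andP[h1 h2] /andP[h3 h4] /andP[h5 h6].
by apply/andP; split; nra.
Qed.

Lemma cell_gap (r : nat) (x x' : cell) (y : pt R d) j :
  knear r x x' -> cube K (cell_pos M x') y ->
  `|y ord0 j - ((x j)%:R - M%:R) * K| <= (r + 1)%:R * K.
Proof.
move=> /(knear_coord j) + /cell_cubeP/(_ j)/andP[h1 h2].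
rewrite natrD; move: h1 h2; move: (y ord0 j) ((x j)%:R : R) ((x' j)%:R : R) (r%:R : R) (M%:R : R).
move=> v c1 c2 r' m h1 h2; rewrite !ler_norml => /andP[h3 h4].
by apply/andP; split; nra.
Qed.

Variables (l B : R).
Hypothesis l0 : 0 < l.
Hypothesis B0 : 0 <= B.
Hypothesis hRA : forall z : Zd d, (cube l z `&` @Lam R d L) !=set0 ->
  (RA alpha (cube l z) xi <= B%:E)%E.

Lemma mass_cube (z : Zd d) : \sum_(u : T | val u \in cube l z) wT alpha i u <= B.
Proof.
have [[u uz]|no] := pselect (exists u : T, val u \in cube l z).
  rewrite -lee_fin; apply: le_trans (hRA (z := z) _); last first.
    by exists (val u); split; [exact: set_mem|exact: (val_in_xiL u).2].
  apply: le_trans (RA_ge alpha xi L _); rewrite lee_fin.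
  by apply: ler_sum => t _; exact: wT_le.
by rewrite big1 // => u uz; case: no; exists u.
Qed.

Definition box_of (t : T) : Zd d := \row_j Num.floor (val t ord0 j / l).

Lemma box_ofP (t : T) : cube l (box_of t) (val t).
Proof.
move=> j; rewrite mxE; have /andP[] := floor_itv (val t ord0 j / l).
by rewrite ler_pdivlMr // ltr_pdivrMr // intrD mulrDl mul1r => -> ->.
Qed.

Lemma floor_gap (u v : R) : u <= v + l -> Num.floor (u / l) <= Num.floor (v / l) + 1.
Proof.
move=> uv; rewrite -ltzD1 -(ltr_int R) !intrD.
have /andP[h1 _] := floor_itv (u / l); have /andP[_] := floor_itv (v / l).
rewrite intrD => h2; apply: le_lt_trans h1 _.
have h3 : u / l <= v / l + 1 by rewrite -[X in _ + X](divff (lt0r_neq0 l0)) -mulrDl ler_pM2r ?invr_gt0.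
by apply: le_lt_trans h3 _; rewrite ltrD2r.
Qed.

(** Such points differ from [v] by at most [l] in each coordinate, so they lie in the [3 ^ d] boxes
    around the box of [v]. *)
Lemma mass_near (r : nat) (v : T) : (r + 4)%:R * K <= l ->
  \sum_(u : T | knear r (nearest_cell u) (nearest_cell v)) wT alpha i u <= (3 ^ d)%:R * B.
Proof.
move=> rl.
pose code (u : T) : {ffun 'I_d -> 'I_3} :=
  [ffun j => inord (absz (box_of u ord0 j - box_of v ord0 j + 1))].
rewrite (partition_big code predT) //=.
have -> : (3 ^ d)%:R * B = \sum_(o : {ffun 'I_d -> 'I_3}) B.
  by rewrite sumr_const card_ffun !card_ord mulr_natl.
apply: ler_sum => o _.
have w0 (u : T) : 0 <= wT alpha i u by exact: wT_ge0.
pose z : Zd d := \row_j (box_of v ord0 j + (o j)%:Z - 1).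
apply: le_trans (mass_cube z); rewrite [leLHS]big_mkcond [leRHS]big_mkcond /=.
apply: ler_sum => u _; case: ifPn => [/andP[uv /eqP uo]|_]; last by case: ifP.
suff -> : z = box_of u by rewrite mem_set //; exact: box_ofP.
apply/rowP => j; rewrite mxE -uo ffunE.
have := val_gap j uv => /le_trans/(_ rl); rewrite ler_norml => /andP[h1 h2].
have g1 : box_of u ord0 j <= box_of v ord0 j + 1.
  by rewrite !mxE; apply: floor_gap; lra.
have g2 : box_of v ord0 j <= box_of u ord0 j + 1.
  by rewrite !mxE; apply: floor_gap; lra.
move: (box_of u ord0 j) (box_of v ord0 j) g1 g2 => p q g1 g2.
have a3 : (absz (p - q + 1)%R < 3)%N by clear - g1 g2; lia.
by rewrite inordK // gez0_abs; clear - g1 g2; lia.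
Qed.

Hypothesis sn : (s <= n)%N.
Hypothesis s_large : (2 ^ (d + 3) * (m0 * 3 ^ d) <= s)%N.
Hypothesis s_small : (s.*2 + (b + 3) + 4)%:R * K <= l.

(** A point and the representative of its cell differ by at most [b + 3] cell sides per coordinate,
    representatives of adjacent cells by at most [2 * b + 3]; the value [2 * b + 6] covers both. *)
Definition kern_far : R := expR (- ((d%:R * ((2 * b + 6)%:R * K)) `^ alpha)).
Definition kern_close : R := expR (- ((d%:R * (3 * K)) `^ alpha)).

Lemma geometric_isoperimetry (t : R) (U : set (pt R d)) :
  U `<=` S -> U !=set0 -> Wt i alpha S U <= t * Wt i alpha S S -> t <= 2^-1 ->
  let mu := (3 ^ d)%:R * B in
  [/\ 0 < Wt i alpha S U, (s.+1 ^ d)%:R * Wt i alpha S S <= mu * (n.+1 ^ d)%:R &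
    kern_far <= 2 * mu * Iso i alpha S U \/
    exists q E : nat, [/\ (s.+1 ^ d)%:R * Wt i alpha S U <= 2 * mu * q%:R,
      (q ^ d.-1 <= (2 ^ (d + 5) * E) ^ d)%N &
      kern_close * E%:R <= Wt i alpha S U * Iso i alpha S U]].
Proof.
move=> US [p Up] Ut t2 mu.
have [rep repP] := rep_exists.
have mu0 : 0 <= mu by rewrite mulr_ge0.
have k0 (u v : T) : 0 <= kT alpha u v by exact/ltW/kern_gt0.
have kC (u v : T) : kT alpha u v = kT alpha v u by exact: kernC.
have w0 (u : T) : 0 <= wT alpha i u by exact: wT_ge0.
have kf0 : 0 <= kern_far by exact: expR_ge0.
have kc0 : 0 <= kern_close by exact: expR_ge0.
have lm (v : T) : \sum_(u : T | knear (s.*2 + (b + 3)) (nearest_cell u) (nearest_cell v))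
    wT alpha i u <= mu by exact: mass_near.
have rep_gap (x : cell) j : `|val (rep x) ord0 j - ((x j)%:R - M%:R) * K| <= (b + 1)%:R * K.
  by have [x' [xx' x'P _]] := repP x; exact: cell_gap xx' x'P.
have rep_in (x : cell) : x \notin Z -> cube K (cell_pos M x) (val (rep x)).
  by move=> xZ; have [x' [_ + /(_ xZ) x'x]] := repP x; rewrite x'x.
(* The representative is within [b + 1] cell sides of the corner of [x], and [nearest_cell] adds
   2. *)
have jr (x : cell) : knear (b + 3) x (nearest_cell (rep x)).
  apply: knear_of_coord => j; have := rep_gap x j; have := nearest_cellP (rep x) j.
  move: (val (rep x) ord0 j) ((nearest_cell (rep x) j)%:R : R) ((x j)%:R : R) (M%:R : R).
  move=> v c1 c2 m; rewrite !natrD !ler_norml => /andP[h1 h2] /andP[h3 h4].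
  by apply/andP; split; nra.
have kjc (u : T) : kern_far <= kT alpha u (rep (nearest_cell u)).
  apply: kern_ge => // j; have := rep_gap (nearest_cell u) j; have := nearest_cellP u j.
  move: (val u ord0 j) (val (rep (nearest_cell u)) ord0 j).
  move: ((nearest_cell u j)%:R : R) (M%:R : R) => c m v v'.
  rewrite [(2 * b + 6)%:R]natrD [(b + 1)%:R]natrD natrM !ler_norml => /andP[h1 h2] /andP[h3 h4].
  have : 0 <= b%:R :> R by [].
  by move: (b%:R : R) h3 h4 => b' h3 h4 b'0; apply/andP; split; nra.
have gap3 r (x y : cell) j (u v : R) : knear 1 x y ->
    `|u - ((x j)%:R - M%:R) * K| <= r -> `|v - ((y j)%:R - M%:R) * K| <= r ->
    `|u - v| <= 2 * r + K.
  move=> /(knear_coord j); rewrite mul1r.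
  move: ((x j)%:R : R) ((y j)%:R : R) (M%:R : R) => c1 c2 m.
  rewrite !ler_norml => /andP[h1 h2] /andP[h3 h4] /andP[h5 h6].
  by apply/andP; split; lra.
have kadj (x y : cell) : knear 1 x y -> kern_far <= kT alpha (rep x) (rep y).
  move=> xy; apply: kern_ge => // j.
  apply: le_trans (gap3 _ x y j _ _ xy (rep_gap x j) (rep_gap y j)) _.
  by rewrite [(2 * b + 6)%:R]natrD [(b + 1)%:R]natrD natrM; have : 0 <= b%:R :> R by []; move: (b%:R : R) => b' b'0; have K0' := K0; lra.
have kopen (x y : cell) : x \notin Z -> y \notin Z -> knear 1 x y ->
    kern_close <= kT alpha (rep x) (rep y).
  move=> xZ yZ xy; apply: kern_ge => // j.
  have hx := cell_gap j (knear_refl 0 x) (rep_in x xZ).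
  have hy := cell_gap j (knear_refl 0 y) (rep_in y yZ).
  apply: le_trans (gap3 _ x y j _ _ xy hx hy) _.
  by rewrite add0n; lra.
have rinj : {in finset.setC Z &, injective rep}.
  move=> x y; rewrite !finset.in_setC => xZ yZ xy; apply/ffunP => j; apply/val_inj => /=.
  have /cell_cubeP/(_ j)/andP[h1 h2] := rep_in x xZ.
  have /cell_cubeP/(_ j)/andP[] := rep_in y yZ; rewrite -xy => h3 h4.
  have hx : ((x j)%:R : R) < (y j).+1%:R.
    by rewrite -[(y j).+1%:R]natr1 -(ltr_pM2r K0); have := le_lt_trans h1 h4; rewrite !mulrBl mulrDl mul1r addrAC ltrD2r.
  have hy : ((y j)%:R : R) < (x j).+1%:R.
    by rewrite -[(x j).+1%:R]natr1 -(ltr_pM2r K0); have := le_lt_trans h3 h2; rewrite !mulrBl mulrDl mul1r addrAC ltrD2r.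
  by rewrite !ltr_nat !ltnS in hx hy; apply/eqP; rewrite eqn_leq hx hy.
have cardX : #|[set: cell]%SET| = (n.+1 ^ d)%N by rewrite cardsT card_ffun !card_ord.
(* At most one eighth of the at least four cells is empty, so two cells are occupied, and their
   representatives are distinct. This makes every weight positive. *)
have two (u : T) : exists v : T, v != u.
  have : (1 < #|finset.setC Z|)%N.
    have h := not_sparse_bad (@kconnected_setT d n) _.
    rewrite cardX finset.setTI in h.
    have {}h := h (leq_trans bd _); rewrite leq_exp2r // ltnS in h.
    have {}h := h bn.
    have hZ : (8 * #|Z| <= n.+1 ^ d)%N.
      by apply: leq_trans h; rewrite -mulnA leq_mul2l leq_pmull // expn_gt0.
    have h4 : (2 ^ 2 <= n.+1 ^ d)%N.
      apply: (@leq_trans (n.+1 ^ 2)); last by rewrite leq_pexp2l.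
      by rewrite leq_exp2r // nE -[2%N]/(1.*2) leq_double.
    have := cardsC Z; rewrite -cardsT cardX.
    by move: hZ h4; move: (n.+1 ^ d)%N #|Z| #|finset.setC Z| => e f g; clear; lia.
  case/card_gt1P => x [y [xZ yZ xy]].
  have [xu|xu] := eqVneq (rep x) u; last by exists (rep x).
  exists (rep y); rewrite -xu; apply: contraNneq xy => e.
  by apply/eqP; apply: rinj => //.
have wpos : 0 < Wt i alpha S U.
  rewrite WtE //; have pT : p \in T by rewrite in_fset_set; [apply/mem_set/US|exact: xiL_finite].
  rewrite /total_weight (bigD1 (FSetSub pT)) /=; last by rewrite finset.inE; apply/mem_set.
  have [v vp] := two (FSetSub pT).
  by rewrite ltr_pwDl ?(wT_gt0 _ _ vp) // sumr_ge0.
split => //.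
  rewrite WtE // setT_of_xiL.
  apply: le_trans (double_counting d1 sn w0 kf0 mu0 lm _) _.
  rewrite ler_wpM2l // ler_nat (leq_trans (max_card _)) //.
  by rewrite card_ffun !card_ord.
rewrite WtE //.
have wU : 0 < total_weight (@wT R d alpha xi L i) (setT_of xi L U) by rewrite -WtE.
have Iso_cut : Iso i alpha S U * total_weight (@wT R d alpha xi L i) (setT_of xi L U) =
    edge_cut (@kT R d alpha xi L) (setT_of xi L U) by rewrite IsoE // mulrC mulVKf ?gt_eqF.
have UUc : total_weight (@wT R d alpha xi L i) (setT_of xi L U) <=
    total_weight (@wT R d alpha xi L i) (finset.setC (setT_of xi L U)).
  have sT : total_weight (@wT R d alpha xi L i) [set: T]%SET =
      total_weight (@wT R d alpha xi L i) (setT_of xi L U) +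
      total_weight (@wT R d alpha xi L i) (finset.setC (setT_of xi L U)).
    rewrite /total_weight (bigID (mem (setT_of xi L U))) /=; congr (_ + _); apply: eq_bigl => u.
      by rewrite !finset.inE.
    by rewrite !finset.inE.
  have s0 : 0 <= total_weight (@wT R d alpha xi L i) [set: T]%SET by exact: sumr_ge0.
  have := ler_wpM2r s0 t2; move: Ut; rewrite !WtE // setT_of_xiL // => h1 h2.
  by have := le_trans h1 h2; rewrite sT; lra.
have [h|[q [E [h1 h2 h3]]]] := points_isoperimetry d1 sn w0 k0 kC kf0 mu0 lm jr kjc kadj kopen
    rinj not_sparse_bad s_large kc0 UUc.
  by left; rewrite -(ler_pM2r wU) -[X in _ <= X]mulrA Iso_cut.
by right; exists q, E; split => //; rewrite [X in _ <= X]mulrC Iso_cut.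
Qed.

End Geometry.

(** * Asymptotics and conclusion *)

Section Asymptotics.
Variable R : realType.

Lemma near_le_ln (Y : R) : \forall L \near \oo, Y <= ln (L%:R : R).
Proof.
exists (Num.truncn (expR Y)).+1 => // L /= YL.
have hL : expR Y < L%:R by apply: lt_le_trans (truncnS_gt _) _; rewrite ler_nat.
by rewrite -ler_expR lnK ?posrE ?(lt_trans (expR_gt0 Y)) // ltW.
Qed.

(** The exponential is at least its quadratic term, and the square of [ln L] outgrows [ln L]. *)
Lemma near_ln_le_powR (a e : R) : 0 < e -> \forall L \near \oo, a * ln (L%:R : R) <= L%:R `^ e.
Proof.
move=> e0; near=> L.
have y0 : 0 <= ln (L%:R : R) by near: L; exact: near_le_ln.
have ya : 2 * a / e ^+ 2 <= ln (L%:R : R) by near: L; exact: near_le_ln.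
have L0 : 0 < (L%:R : R) by rewrite ltr0n; near: L; exact: nbhs_infty_gt.
rewrite /powR gt_eqF //; apply: le_trans (expR_ge1Dxn 1 (mulr_ge0 (ltW e0) y0)).
move: ya; rewrite ler_pdivrMr ?exprn_gt0 // => ya.
move: (ln (L%:R : R)) y0 ya => y y0 ya.
rewrite (_ : 2`! = 2)%N // exprMn.
have : 0 <= (y * e ^+ 2 - 2 * a) * y by rewrite mulr_ge0 // subr_ge0.
rewrite expr2; move: (e ^+ 2) => e2; nra.
Unshelve. all: by end_near. Qed.

Lemma trunc_log_le_ln (L : nat) : 1 <= ln (L%:R : R) ->
  (trunc_log 2 L).+1%:R <= ((ln 2)^-1 + 1) * ln (L%:R : R).
Proof.
move=> y1; have L0 : (0 < L)%N.
  by case: L y1 => // ; rewrite ln0 // ler10.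
have ln20 : 0 < ln (2 : R) by rewrite ln_gt0 // ltr1n.
have h : (2 : R) ^+ trunc_log 2 L <= L%:R by rewrite -natrX ler_nat trunc_logP.
rewrite -[(_).+1%:R]natr1 mulrDl mul1r lerD // mulrC ler_pdivlMr // mulr_natl -lnXn //.
by rewrite ler_ln ?posrE ?exprn_gt0 // ltr0n.
Qed.

Lemma powR_root (x : R) (d : nat) : (0 < d)%N -> 0 <= x -> (x `^ d%:R^-1) ^+ d = x.
Proof.
by move=> d0 x0; rewrite -powR_mulrn ?powR_ge0 // -powRrM mulVf ?powRr1 // pnatr_eq0 -lt0n.
Qed.

(** The last bound is where [alpha < d] enters: [b] is of order [(ln L)^(1/d)], so the exponent in
    [kern_far] is of order [(ln L)^(alpha/d)], which is negligible against [ln L]. *)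
Lemma near_scales (K alpha eps e1 : R) (d : nat) : 0 < K -> (1 < d)%N ->
  0 < alpha < d%:R -> 0 < eps -> 0 < e1 <= 1 ->
  \forall L \near \oo,
    let m0 := (trunc_log 2 L).+1 in
    let b := Num.truncn ((m0%:R : R) `^ d%:R^-1) in
    let s := Num.truncn (L%:R `^ e1 / (8 * K)) in
    let n := (half_side K L).*2.-1 in
    [/\ [/\ (0 < L)%N, (0 < half_side K L)%N & (m0 <= b.+1 ^ d)%N],
      [/\ (b <= n)%N, (s <= n)%N & (2 ^ (d + 3) * (m0 * 3 ^ d) <= s)%N],
      (s.*2 + (b + 3) + 4)%:R * K <= L%:R `^ e1 &
      (L%:R `^ (eps / 2))^-1 <= kern_far d alpha K b].
Proof.
move=> K0 d1 /andP[a0 ad] eps0 /andP[e10 e11].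
have d0 : (0 < d)%N by exact: ltnW.
pose c2 : R := (ln 2)^-1 + 1; pose C : R := (2 ^ (d + 3) * 3 ^ d)%N%:R.
pose be := alpha / d%:R.
have be1 : 0 < 1 - be by rewrite subr_gt0 ltr_pdivrMr ?ltr0n // mul1r.
have c20 : 0 < c2 by rewrite ltr_wpDl // invr_ge0 ln_ge0 // ler1n.
(* [c3] comes from [2 * b + 6 <= 8 * m0 ^ (1/d)]; [c4] is the value that [ln L] to the power
   [1 - be] has to exceed. *)
pose c3 : R := 8 * d%:R * K; pose c4 := c3 `^ alpha * c2 `^ be * (2 / eps).
have c40 : 0 <= c4 by rewrite !mulr_ge0 ?powR_ge0 // invr_ge0 ltW.
have [LM hLM] := half_side_ge K0 1.
near=> L.
set m0 := (trunc_log 2 L).+1; set b := Num.truncn (m0%:R `^ _).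
set s := Num.truncn (L%:R `^ e1 / _); set n := (half_side K L).*2.-1.
have y1 : 1 <= ln (L%:R : R) by near: L; exact: near_le_ln.
have y4 : c4 `^ (1 - be)^-1 <= ln (L%:R : R) by near: L; exact: near_le_ln.
have yK : 4 * K <= ln (L%:R : R) by near: L; exact: near_le_ln.
have yL : 1 * ln (L%:R : R) <= L%:R `^ 1 by near: L; exact: near_ln_le_powR.
have bL : 8 * K * c2 * ln (L%:R : R) <= L%:R `^ 1 by near: L; exact: near_ln_le_powR.
have sL : 8 * K * (C * c2 + 1) * ln (L%:R : R) <= L%:R `^ e1 by near: L; exact: near_ln_le_powR.
have tL : 2 * K * (c2 + 7) * ln (L%:R : R) <= L%:R `^ e1 by near: L; exact: near_ln_le_powR.
have M0 : (0 < half_side K L)%N by near: L; exists LM.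
have L0 : (0 < L)%N by near: L; exact: nbhs_infty_gt.
have L1 : 1 <= (L%:R : R) by rewrite ler1n.
rewrite powRr1 ?(le_trans ler01) // in yL bL; rewrite mul1r in yL.
have y0 : 0 < ln (L%:R : R) by exact: lt_le_trans y1.
have m0y : m0%:R <= c2 * ln (L%:R : R) by exact: trunc_log_le_ln.
have m01 : 1 <= (m0%:R : R) by rewrite ler1n.
have m0root : 1 <= (m0%:R : R) `^ d%:R^-1.
  by rewrite -[leLHS](powRr0 m0%:R) ler_powR // invr_ge0.
have rootm0 : (m0%:R : R) `^ d%:R^-1 <= m0%:R.
  by rewrite -[leRHS]powRr1 // ler_powR // invf_le1 ?ltr0n // ler1n.
have /andP[b1 b2] : b%:R <= (m0%:R : R) `^ d%:R^-1 < b.+1%:R by apply: truncn_itv; exact: powR_ge0.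
have bm0 : (b%:R : R) <= m0%:R by exact: le_trans rootm0.
have le1 : L%:R `^ e1 <= L%:R by rewrite -[leRHS]powRr1 ?ler_powR // (le_trans ler01).
have q0 : 0 <= L%:R `^ e1 / (8 * K) by rewrite divr_ge0 ?powR_ge0 // mulr_ge0 // ltW.
have /andP[] := truncn_itv q0; rewrite -/s -[s.+1%:R]natr1.
rewrite ler_pdivlMr ?mulr_gt0 // ltr_pdivrMr ?mulr_gt0 // => s1 s2.
have /andP[_ ML] := half_side_bounds K0 L.
have nE : n%:R + 1 = (half_side K L)%:R + (half_side K L)%:R :> R.
  by rewrite natr1 /n prednK ?double_gt0 // -addnn natrD.
have n_large : L%:R <= 8 * K * n%:R.
  move: ML nE yK yL; move: ((half_side K L)%:R : R) (n%:R : R) (ln _) => m n' y ML nE yK yL.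
  by rewrite (_ : n' = m + m - 1); [nra|lra].
have K8 : 0 < 8 * K by rewrite mulr_gt0.
have bK : 8 * K * b%:R <= 8 * K * (c2 * ln (L%:R : R)).
  by rewrite ler_pM2l // (le_trans bm0).
split; [split=> //|split|..].
- rewrite -(ler_nat R) natrX -[leLHS](powR_root d0) // lerXn2r ?nnegrE ?powR_ge0 //.
  exact: ltW.
- by rewrite -(ler_nat R) -(ler_pM2l K8); lra.
- by rewrite -(ler_nat R) -(ler_pM2l K8); lra.
- rewrite -ltnS -(ltr_nat R) -[s.+1%:R]natr1 -(ltr_pM2l K8).
  apply: le_lt_trans (_ : 8 * K * (C * c2 * ln (L%:R : R)) < _).
    rewrite ler_pM2l // mulnCA mulnC natrM -/C -mulrA ler_wpM2l //.
  by apply: le_lt_trans (_ : L%:R `^ e1 - 8 * K < _); nra.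
- rewrite !natrD -muln2 natrM.
  have : b%:R <= c2 * ln (L%:R : R) by exact: le_trans m0y.
  by move: (b%:R : R) (s%:R : R) s1 => b' s' s1 hb; nra.
rewrite -powRN /powR gt_eqF ?(lt_le_trans ltr01) // /kern_far ler_expR mulNr lerN2.
have base : d%:R * ((2 * b + 6)%:R * K) <= c3 * m0%:R `^ d%:R^-1.
  have h : (2 * b + 6)%:R <= 8 * (m0%:R : R) `^ d%:R^-1 by rewrite natrD natrM; lra.
  have dK : 0 <= d%:R * K by rewrite mulr_ge0 // ltW.
  have -> : d%:R * ((2 * b + 6)%:R * K) = d%:R * K * (2 * b + 6)%:R by rewrite mulrA mulrAC.
  by apply: le_trans (ler_wpM2l dK h) _; rewrite /c3 le_eqVlt; apply/orP; left; apply/eqP; ring.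
apply: le_trans (_ : (c3 * m0%:R `^ d%:R^-1) `^ alpha <= _).
  apply: ge0_ler_powR => //; first exact: ltW.
  - by rewrite nnegrE !mulr_ge0 // ltW.
  - by rewrite nnegrE !mulr_ge0 // ?powR_ge0 // ltW.
rewrite powRM ?powR_ge0 //; last by rewrite !mulr_ge0 // ltW.
rewrite -powRrM [d%:R^-1 * _]mulrC -/be.
apply: le_trans (_ : c3 `^ alpha * (c2 * ln (L%:R : R)) `^ be <= _).
  rewrite ler_wpM2l ?powR_ge0 //; apply: ge0_ler_powR; rewrite ?nnegrE //.
  - by rewrite divr_ge0 // ltW.
  - by rewrite mulr_ge0 // ltW.
rewrite powRM ?(ltW c20) ?(ltW y0) //.
have c4y : c4 <= ln (L%:R : R) `^ (1 - be).
  have e : c4 = (c4 `^ (1 - be)^-1) `^ (1 - be).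
    by rewrite -powRrM mulVf ?powRr1 // lt0r_neq0.
  rewrite [leLHS]e.
  by apply: ge0_ler_powR => //; rewrite ?nnegrE ?powR_ge0 // ltW.
have yy : ln (L%:R : R) `^ be * ln (L%:R : R) `^ (1 - be) = ln (L%:R : R).
  rewrite -powRD; last by apply/implyP => _; rewrite gt_eqF.
  by rewrite addrC subrK powRr1 // ltW.
rewrite -[X in _ <= _ * X]yy.
have e2 : c3 `^ alpha * c2 `^ be = eps / 2 * c4.
  by rewrite /c4; field; rewrite gt_eqF.
rewrite mulrA e2 -mulrA ler_pM2l ?divr_gt0 // mulrC ler_wpM2l ?powR_ge0 //.
Unshelve. all: by end_near. Qed.

End Asymptotics.

Lemma as_eventually_and (R : realType) (d : nat) (P : probability (Omega R d) R)
    (E F G : nat -> config R d -> Prop) :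
  as_eventually P E -> as_eventually P F ->
  (\forall L \near \oo, forall xi, E L xi -> F L xi -> G L xi) ->
  as_eventually P G.
Proof.
move=> [B1 [mB1 PB1 E1]] [B2 [mB2 PB2 E2]] [L0 _ EFG].
have mI : measurable (B1 `&` B2) by exact: measurableI.
exists (B1 `&` B2); split => //.
  have h : (P (~` (B1 `&` B2)) <= 0)%E.
    rewrite setCI; apply: (@le_trans _ _ (P (~` B1) + P (~` B2))%E).
      by apply: measureU2; exact: measurableC.
    by rewrite !probability_setC // PB1 PB2 subee // adde0.
  have := probability_setC P (measurableC mI).
  rewrite setCK => ->; rewrite (_ : P (~` _) = 0%E) ?sube0 //.
  by apply/eqP; rewrite eq_le h measure_ge0.
move=> xi [x1 x2]; have [L1 h1] := E1 xi x1; have [L2 h2] := E2 xi x2; exists (maxn L0 (maxn L1 L2)) => L.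
rewrite !geq_max => /and3P[l0 l1 l2].
by apply: (EFG L l0); [exact: h1|exact: h2].
Qed.

(* [W ^+ d.-1] is at most a multiple of [q ^ d.-1], hence of [E ^ d], hence of [(W * Is) ^+ d];
   cancelling [W ^+ d.-1] leaves [W * Is ^+ d] bounded below. *)
Lemma ratio_lower_bound (R : realType) (d : nat) (c4 c5 kc t L W WS Is : R) (q E N : nat) :
  (1 < d)%N -> 0 < c4 -> 0 < c5 -> 0 < kc -> 0 < t -> 0 < L -> 0 < W ->
  W <= t * WS -> WS <= c4 * N%:R ^+ d -> N%:R <= c5 * L ->
  W <= c4 * q%:R -> (q ^ d.-1 <= (2 ^ (d + 5) * E) ^ d)%N -> kc * E%:R <= W * Is ->
  (2 ^+ (d + 5) * c5 * c4 / kc)^-1 * (t `^ d%:R^-1 * L)^-1 <= Is.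
Proof.
move=> d1 c40 c50 kc0 t0 L0 W0 WWS WSN NL Wq qE EI.
have d0 : (0 < d)%N by exact: ltnW.
pose a : R := 2 ^+ (d + 5).
have a0 : 0 < a by exact: exprn_gt0.
have Is0 : 0 <= Is.
  by rewrite -(pmulr_rge0 _ W0); apply: le_trans EI; rewrite mulr_ge0 // ltW.
have pred_exp (x : R) : x ^+ d = x * x ^+ d.-1 by rewrite -exprS prednK.
have h1 : W ^+ d.-1 <= c4 ^+ d.-1 * (a / kc * (W * Is)) ^+ d.
  apply: (@le_trans _ _ ((c4 * q%:R) ^+ d.-1)).
    by rewrite lerXn2r ?nnegrE ?mulr_ge0 // ltW.
  rewrite exprMn ler_wpM2l ?exprn_ge0 ?(ltW c40) //.
  apply: (@le_trans _ _ ((a * E%:R) ^+ d)).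
    by rewrite -natrX -[a]natrX -natrM -natrX ler_nat.
  have kE : E%:R <= kc^-1 * (W * Is) by rewrite ler_pdivlMl.
  have aE : a * E%:R <= a / kc * (W * Is) by rewrite -mulrA ler_pM2l.
  have aE0 : 0 <= a * E%:R by rewrite mulr_ge0 // ltW.
  by apply: lerXn2r => //; rewrite nnegrE // (le_trans aE0).
have h2 : 1 <= c4 ^+ d.-1 * (a / kc) ^+ d * W * Is ^+ d.
  rewrite -(ler_pM2l (exprn_gt0 d.-1 W0)) mulr1; apply: le_trans h1 _.
  rewrite !exprMn (pred_exp W) le_eqVlt; apply/orP; left; apply/eqP.
  by move: (c4 ^+ _) (a ^+ _) (kc^-1 ^+ _) (W ^+ _) (Is ^+ _) => *; ring.
have h3 : W <= t * c4 * (c5 * L) ^+ d.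
  apply: le_trans WWS _; rewrite -mulrA ler_pM2l //; apply: le_trans WSN _.
  by rewrite ler_pM2l // lerXn2r ?nnegrE ?mulr_ge0 // ltW.
have r0 : 0 < t `^ d%:R^-1 by exact: powR_gt0.
have h4 : 1 <= (a * c5 * c4 / kc * (t `^ d%:R^-1 * L) * Is) ^+ d.
  apply: le_trans h2 _.
  apply: (@le_trans _ _ (c4 ^+ d.-1 * (a / kc) ^+ d * (t * c4 * (c5 * L) ^+ d) * Is ^+ d)).
    rewrite ler_wpM2r ?exprn_ge0 // ler_wpM2l // mulr_ge0 ?exprn_ge0 ?(ltW c40) //.
    by rewrite divr_ge0 // ltW.
  have -> : t * c4 * (c5 * L) ^+ d = t `^ d%:R^-1 ^+ d * c4 * (c5 * L) ^+ d.
    by rewrite powR_root // ltW.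
  rewrite !exprMn (pred_exp c4) le_eqVlt; apply/orP; left; apply/eqP.
  move: (c4 ^+ _) (a ^+ _) (kc^-1 ^+ _) (c5 ^+ _) (L ^+ _) (Is ^+ _) => *.
  by move: (t `^ _ ^+ _) => *; ring.
have h5 : 1 <= a * c5 * c4 / kc * (t `^ d%:R^-1 * L) * Is.
  have nn : 0 <= a * c5 * c4 / kc * (t `^ d%:R^-1 * L) * Is.
    by rewrite !mulr_ge0 ?invr_ge0 ?(ltW a0) ?(ltW c50) ?(ltW c40) ?(ltW kc0) ?(ltW r0) ?(ltW L0).
  by rewrite -(ler_pXn2r d0) ?nnegrE ?expr1n.
by rewrite -invfM -[leLHS]mulr1 ler_pdivrMl // !mulr_gt0 ?invr_gt0.
Qed.

Theorem theorem1p1 (R : realType) (d : nat) (alpha : R)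
    (P : probability (Omega R d) R) :
  (2 <= d)%N -> 0 < alpha < d%:R -> A1 P -> A2 alpha P ->
  (forall i : nat, (1 <= i <= 3)%N -> forall eps : R, 0 < eps ->
    exists delta : R, 0 < delta /\
      as_eventually P (fun L xi => forall t : R, 0 < t <= 2^-1 ->
        ((delta * Num.min (L%:R `^ eps)^-1 ((t `^ (d%:R^-1) * L%:R)^-1))%:E
           <= profile i alpha (xiL xi L) t)%E))
  /\
  (forall i : nat, (1 <= i <= 3)%N ->
    exists delta : R, 0 < delta /\
      as_eventually P (fun L xi =>
        ((delta / L%:R)%:E <= cheeger i alpha (xiL xi L))%E)).
Proof.
move=> d1 ad hA1 hA2; have /andP[a0 a1] := ad.
have main : forall i : nat, forall eps : R, 0 < eps ->
    exists delta : R, 0 < delta /\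
      as_eventually P (fun L xi => forall t : R, 0 < t <= 2^-1 ->
        ((delta * Num.min (L%:R `^ eps)^-1 ((t `^ (d%:R^-1) * L%:R)^-1))%:E
           <= profile i alpha (xiL xi L) t)%E).
  move=> i eps eps0.
  have d0 : (0 < d)%N by exact: ltnW.
  have dR : 0 < (d%:R : R) by rewrite ltr0n.
  have d2R : 2 <= (d%:R : R) by rewrite ler_nat.
  (* Then the volume [l ^+ d] of a box is at most [L ^ (eps / 2)], which leaves the other half of
     [eps] to [kern_far]. *)
  pose e1 := Num.min eps 1 / (2 * d%:R).
  have min0 : 0 < Num.min eps 1 by rewrite lt_min eps0 ltr01.
  have min1 : Num.min eps 1 <= 1 by rewrite ge_min lexx orbT.
  have mine : Num.min eps 1 <= eps by rewrite ge_min lexx.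
  have e10 : 0 < e1 by rewrite divr_gt0 // mulr_gt0.
  have e11 : e1 < 1.
    by rewrite ltr_pdivrMr ?mulr_gt0 // mul1r (le_lt_trans min1) //; lra.
  have e1d : e1 * d%:R <= eps / 2.
    have -> : e1 * d%:R = Num.min eps 1 / 2 by rewrite /e1; field; rewrite gt_eqF.
    by rewrite ler_pM2r // invr_gt0.
  have [K [K0 sparseE]] := eventually_sparse hA1.
  have e1P : 0 < e1 < 1 by rewrite e10.
  have [C massE] := hA2 e1 e1P.
  pose C1 := Num.max C 1.
  have C10 : 0 < C1 by rewrite lt_max ltr01 orbT.
  have CC1 : C <= C1 by rewrite le_max lexx.
  pose mu3 : R := (3 ^ d)%:R * C1.
  have mu30 : 0 < mu3 by rewrite mulr_gt0 // ltr0n expn_gt0.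
  pose kc := kern_close d alpha K.
  have kc0 : 0 < kc by exact: expR_gt0.
  pose c4 := 2 * mu3 * (8 * K) ^+ d.
  have c40 : 0 < c4 by rewrite !mulr_gt0 ?exprn_gt0 ?mulr_gt0.
  pose da := (2 * mu3)^-1; pose db := (2 ^+ (d + 5) * K^-1 * c4 / kc)^-1.
  have da0 : 0 < da by rewrite invr_gt0 mulr_gt0.
  have db0 : 0 < db.
    rewrite invr_gt0; apply: divr_gt0 => //; apply: mulr_gt0 => //.
    by apply: mulr_gt0; rewrite ?invr_gt0 ?exprn_gt0.
  exists (Num.min da db); split; first by rewrite lt_min da0.
  have e1P' : 0 < e1 <= 1 by rewrite e10 ltW.
  have scales := near_scales K0 d1 ad eps0 e1P'.
  apply: as_eventually_and sparseE massE _.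
  apply: filterS scales => L [[L0 M0 mb] [bn sn sl] ss kf] xi sparse mass t /andP[t0 t2].
  apply: le_ereal_inf_tmp => _ [U [US U0 Ut] <-]; rewrite lee_fin.
  have LR : 0 < (L%:R : R) by rewrite ltr0n.
  have L1 : 1 <= (L%:R : R) by rewrite ler1n.
  pose l := L%:R `^ e1; have l0 : 0 < l by exact: powR_gt0.
  have ld : L%:R `^ (e1 * d%:R) = l ^+ d by rewrite powRrM powR_mulrn // ltW.
  pose B := C1 * l ^+ d.
  have B0 : 0 <= B by rewrite mulr_ge0 ?exprn_ge0 ?(ltW C10) ?(ltW l0).
  have hRA (z : Zd d) : (cube l z `&` @Lam R d L) !=set0 ->
      (RA alpha (cube l z) xi <= B%:E)%E.
    move=> /mass/le_trans; apply; rewrite lee_fin /B ld ler_wpM2r ?exprn_ge0 //.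
    exact: ltW.
  have [W0 tot alt] := geometric_isoperimetry d1 a0 K0 M0 sparse mb bn l0 B0 hRA sn sl ss
    US U0 Ut t2.
  have muE : (3 ^ d)%:R * B = mu3 * l ^+ d by rewrite /B mulrA.
  rewrite muE in tot alt.
  set s := Num.truncn _ in sn sl ss tot alt.
  have s8 : (l / (8 * K)) ^+ d <= (s.+1 ^ d)%:R.
    have q0 : 0 <= l / (8 * K) by rewrite divr_ge0 ?mulr_ge0 ?(ltW K0) ?(ltW l0).
    rewrite natrX lerXn2r ?nnegrE //; apply: ltW.
    by have /andP[] := truncn_itv q0.
  have K8 : 0 < (8 * K) ^+ d by rewrite exprn_gt0 // mulr_gt0.
  have lK : 0 < l ^+ d by exact: exprn_gt0.
  (* As [s.+1] is at least [l / (8 * K)], the volume of a box cancels: the bulk estimate does not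
     depend on the scale [l]. *)
  have scale (X Y : R) : 0 <= X -> (s.+1 ^ d)%:R * X <= l ^+ d * Y -> X <= (8 * K) ^+ d * Y.
    move=> X0 h; have := le_trans (ler_wpM2r X0 s8) h.
    by rewrite exprMn exprVn -[_ / _ * X]mulrA ler_pM2l // mulrC ler_pdivrMr // mulrC.
  have dm : 0 <= Num.min da db by rewrite le_min (ltW da0) (ltW db0).
  have tm : 0 <= Num.min (L%:R `^ eps)^-1 ((t `^ d%:R^-1 * L%:R)^-1).
    by rewrite le_min !invr_ge0 mulr_ge0 ?powR_ge0.
  case: alt => [h|[q [E [h1 h2 h3]]]].
    (* Mixed boxes: [L ^ -(eps / 2) <= kern_far <= 2 * mu3 * l ^+ d * Iso], and [l ^+ d] costs the
       second factor [L ^ (eps / 2)]. *)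
    apply: (@le_trans _ _ (da * (L%:R `^ eps)^-1)).
      by apply: ler_pM => //; rewrite ge_min lexx.
    rewrite /da -invfM -[leLHS]mulr1 ler_pdivrMl ?mulr_gt0 ?powR_gt0 //.
    have h' := le_trans kf h.
    have p0 : 0 < L%:R `^ (eps / 2) by exact: powR_gt0.
    rewrite -[leLHS](mulfV (lt0r_neq0 p0)) [leLHS]mulrC.
    have Is0 : 0 <= Iso i alpha (xiL xi L) U.
      have : 0 <= 2 * (mu3 * l ^+ d) * Iso i alpha (xiL xi L) U by apply: le_trans h'; rewrite invr_ge0 ltW.
      by rewrite pmulr_rge0 // !mulr_gt0.
    apply: le_trans (ler_wpM2r (ltW p0) h') _.
    have -> : L%:R `^ eps = L%:R `^ (eps / 2) * L%:R `^ (eps / 2).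
      by rewrite -powRD ?gt_eqF ?implybT // -splitr.
    have lle : l ^+ d <= L%:R `^ (eps / 2) by rewrite -ld ler_powR.
    have := ler_wpM2r (ltW p0) lle.
    have m0 : 0 <= 2 * mu3 * Iso i alpha (xiL xi L) U by rewrite mulr_ge0 // mulr_ge0 // ltW.
    move=> hh; have := ler_wpM2l m0 hh.
    move: (L%:R `^ (eps / 2)) (l ^+ d) (Iso _ _ _ _) => x y z; lra.
  apply: (@le_trans _ _ (db * (t `^ d%:R^-1 * L%:R)^-1)).
    by apply: ler_pM => //; rewrite ge_min lexx orbT.
  have WS0 : 0 <= Wt i alpha (xiL xi L) (xiL xi L).
    by rewrite -(pmulr_rge0 _ t0); exact: le_trans (ltW W0) Ut.
  have NL : (half_side K L).*2%:R <= K^-1 * L%:R.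
    rewrite mulrC ler_pdivlMr // -muln2 natrM; have /andP[] := half_side_bounds K0 L.
    by lra.
  rewrite nE // in tot.
  apply: (ratio_lower_bound d1 c40 _ kc0 t0 LR W0 Ut _ NL _ h2 h3).
  - by rewrite invr_gt0.
  - apply: le_trans (scale _ (mu3 * (half_side K L).*2%:R ^+ d) WS0 _) _.
      by apply: le_trans tot _; rewrite natrX mulrCA mulrA.
    rewrite /c4 mulrA ler_wpM2r ?exprn_ge0 // [leLHS]mulrC ler_wpM2r ?(ltW K8) //.
    by rewrite ler_peMl ?(ltW mu30) // ler1n.
  have -> : c4 * q%:R = (8 * K) ^+ d * (2 * mu3 * q%:R) by rewrite /c4 mulrAC mulrC.
  apply: (scale _ _ (ltW W0)); apply: le_trans h1 _.
  by rewrite le_eqVlt; apply/orP; left; apply/eqP; move: (l ^+ d) (q%:R : R) => *; ring.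
split=> [i _|i _]; first exact: main.
have half0 : 0 < (2^-1 : R) by rewrite invr_gt0.
(* With [eps = 1/2] and [t = 1/2] both terms of the minimum are at least [1 / L]. *)
have [delta [delta0 hE]] := main i 2^-1 half0.
exists delta; split => //; apply: (as_eventually_and hE hE).
exists 1%N => // L /= L0 xi h _.
have LR : 0 < (L%:R : R) by rewrite ltr0n.
have L1 : 1 <= (L%:R : R) by rewrite ler1n.
apply: le_trans (h 2^-1 _); last by rewrite lexx invr_gt0 ltr0n.
rewrite lee_fin ler_pM2l // le_min; apply/andP; split.
  rewrite lef_pV2 ?posrE ?powR_gt0 // -[leRHS]powRr1 // ler_powR //.
  by rewrite invf_le1 // ler1n.
rewrite lef_pV2 ?posrE ?mulr_gt0 ?powR_gt0 // ler_piMl //.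
apply: (@le_trans _ _ (1 `^ d%:R^-1)); last by rewrite powR1.
apply: ge0_ler_powR; rewrite ?nnegrE ?invr_ge0 //.
by rewrite invf_le1 // ler1n.
Qed.
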